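(* Let $\varphi\in H^\infty$ be a nonconstant function with $\|\varphi\|_\infty=1$, and let $\mathcal E\subset\mathbb T$ be a Lebesgue measurable set such that $\varphi$ has an angular derivative at almost every point of $\mathcal E$. Assume that $\log|\varphi'|\in L^1(\mathcal E)$ (where $\varphi'(\zeta)$ denotes the angular derivative at $\zeta$), and let $\mathcal O$ be the outer function with modulus $|\varphi'|\chi_{\mathcal E}+\chi_{\mathbb T\setminus\mathcal E}$, so that $|\mathcal O(z)|=\exp\{\int_{\mathcal E}\log|\varphi'|\,d\omega_z\}$. Then for all $z\in\mathbb D$, $$\frac{1-|\varphi(z)|^2}{1-|z|^2}\le|\mathcal O(z)|\left\{\frac{1}{1-\omega_z(\mathcal E)}\cdot\frac{1+|z|}{1-|z|}\right\}^{1-\omega_z(\mathcal E)}.$$ (When $\omega_z(\mathcal E)=1$, the bracketed factor is interpreted as $1$.)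
   Context: $\mathbb D=\{|z|<1\}$, $\mathbb T=\partial\mathbb D$, $m$ is normalized arclength measure on $\mathbb T$, $H^\infty$ is the algebra of bounded holomorphic functions on $\mathbb D$ with sup norm. A function $\varphi\in H^\infty$ with $\|\varphi\|_\infty\le1$ has an angular derivative at $\zeta\in\mathbb T$ if $\varphi$ and $\varphi'$ have nontangential limits $\varphi(\zeta)$, $\varphi'(\zeta)$ at $\zeta$ and $|\varphi(\zeta)|=1$. The harmonic measure at $z\in\mathbb D$ is $d\omega_z(\zeta)=\frac{1-|z|^2}{|\zeta-z|^2}\,dm(\zeta)$, and $\omega_z(E)=\int_E d\omega_z$. For $h\ge0$ on $\mathbb T$ with $\log h\in L^1(\mathbb T)$, the outer function with modulus $h$ is $\mathcal O_h(z)=\exp\{\int_{\mathbb T}\frac{\zeta+z}{\zeta-z}\log h(\zeta)\,dm(\zeta)\}$; $\chi_E$ denotes the characteristic function of $E$. *)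

(* Defs.v *)
From HB Require Import structures.
From mathcomp Require Import all_boot all_order all_algebra.
From mathcomp Require Import all_classical all_reals all_analysis.
From mathcomp Require Import complex.
Set Implicit Arguments.
Unset Strict Implicit.
Unset Printing Implicit Defensive.
Import Order.TTheory GRing.Theory Num.Theory.
Local Open Scope ring_scope.
Local Open Scope classical_set_scope.

Section HardyDefs.
Variable R : realType.
Local Notation C := R[i].

Definition cabs (z : C) : R := Num.sqrt (complex.Re z ^+ 2 + complex.Im z ^+ 2).

Definition in_disk (z : C) : Prop := cabs z < 1.

(* the point e^{it} of the unit circle T; T is parametrized by t in [0, 2pi) *)
Definition expi (t : R) : C := (cos t +i* sin t)%C.

Definition has_cderiv (f : C -> C) (z d : C) : Prop :=
  forall eps : R, 0 < eps -> exists delta : R, 0 < delta /\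
    forall w : C, 0 < cabs (w - z) < delta ->
      cabs ((f w - f z) / (w - z) - d) <= eps.

Definition holomorphic_disk (f : C -> C) : Prop :=
  forall z, in_disk z -> exists d, has_cderiv f z d.

Definition derivative_on_disk (f df : C -> C) : Prop :=
  forall z, in_disk z -> has_cderiv f z (df z).

Definition Hinf (f : C -> C) : Prop :=
  holomorphic_disk f /\ exists M : R, forall z, in_disk z -> cabs (f z) <= M.

Definition sup_norm_disk (f : C -> C) : R :=
  sup [set cabs (f z) | z in in_disk].

Definition nonconstant_disk (f : C -> C) : Prop :=
  exists z w, in_disk z /\ in_disk w /\ f z != f w.

(* nontangential limit of f at zeta equal to L: limit of f(z) as z -> zeta
   inside every Stolz angle {z in D : |z - zeta| < c (1 - |z|)}, c > 1 *)
Definition nt_lim (f : C -> C) (zeta L : C) : Prop :=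
  forall c : R, 1 < c -> forall eps : R, 0 < eps -> exists delta : R, 0 < delta /\
    forall z : C, in_disk z -> cabs (z - zeta) < c * (1 - cabs z) ->
      cabs (z - zeta) < delta -> cabs (f z - L) < eps.

Definition angular_derivative (phi dphi : C -> C) (zeta d : C) : Prop :=
  exists a : C, nt_lim phi zeta a /\ nt_lim dphi zeta d /\ cabs a = 1.

Definition lebT := caratheodory_type (R:=R)
  (T:=lebesgue_stieltjes_measure_ocitv_type__canonical__measurable_structure_SemiRingOfSets R)
  (wlength idfun)^*%mu.

Definition leb : set lebT -> \bar R := @completed_lebesgue_measure R.

Definition lmeasurable (E : set R) : Prop := measurable (E : set lebT).

Definition poisson (z : C) (t : R) : R :=
  (1 - cabs z ^+ 2) / cabs (expi t - z) ^+ 2.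

(* harmonic measure omega_z(E), E a subset of [0, 2pi) encoding {e^{it} : t in E};
   dm = dt / (2 pi) *)
Definition harm_meas (z : C) (E : set R) : R :=
  Rintegral leb (E : set lebT) (fun t : lebT => poisson z t / (2 * pi)).

(* modulus |O_h(z)| of the outer function
   O_h(z) = exp (int_T (zeta + z)/(zeta - z) log h(zeta) dm(zeta)),
   i.e. exp (Re (...)), h given as a function of t in [0, 2pi) *)
Definition outer_abs (h : R -> R) (z : C) : R :=
  expR (Rintegral leb (`[0, 2 * pi[ : set lebT)
    (fun t : lebT => complex.Re ((expi t + z) / (expi t - z)) * ln (h t) / (2 * pi))).

End HardyDefs.

(* Main.v *)
Require Import Defs.
From HB Require Import structures.
From mathcomp Require Import all_boot all_order all_algebra.
From mathcomp Require Import all_classical all_reals all_analysis.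
From mathcomp Require Import complex.
From mathcomp Require Import measurable_realfun ring lra.
Set Implicit Arguments.
Unset Strict Implicit.
Unset Printing Implicit Defensive.
Import Order.TTheory GRing.Theory Num.Theory.
Import numFieldNormedType.Exports.
Local Open Scope ring_scope.
Local Open Scope classical_set_scope.

(** * Complex modulus and complex derivatives *)

(** Fix [z], put [a = phi z] and kz = (1 - |a|^2) / (1 - |z|^2), and consider the de Branges-Rovnyak
    kernel k(w) = (1 - conj(a) phi(w)) / (1 - conj(z) w), for which k(z) = kz. If |a| < 1, numerator
    and denominator have no zero in the disk, so log |k|^2 is harmonic and its mean against harmonic
    measure at [z] is 2 ln kz. The theorem comes from bounding this mean separately over E and over
    the complement of E.

    On E, [schwarz_pick] gives |k(w)|^2 <= kz (1 - |phi(w)|^2) / (1 - |w|^2), and [julia] bounds the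
    last quotient by |phi'| in the radial limit. With w = omega_z(E) and S the integral of log
    |phi'| over E against omega_z, the contribution of E is at most S + w ln kz.

    On the complement, the tangent inequality x <= ln lam - 1 + e^x / lam with x = log |k|^2 passes
    from log |k|^2 to |k|^2. The Poisson kernel is at most c = (1 + |z|) / (1 - |z|), and the
    squared H^2 norm of k is at most kz ([expR_log_kernel_mean]), so the contribution is at most (ln
    lam - 1)(1 - w) + c kz / lam. The sum of both bounds is [kernel_inequality]; the choice lam = c
    kz / (1 - w) leaves ln kz <= S + (1 - w) ln (c / (1 - w)) ([optimize_tangent]).

    The estimates are made on circles of radius r < 1, with r tending to 1; on E the limit rests on
    dominated convergence ([cvg_Rintegral_max]). The complex analysis is derived from real integrals
    only: Goursat's theorem on rectangles yields a mean value property that tolerates one point of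
    mere continuity ([mean_value]). From it follow [poisson_formula], the Schwarz lemma and, by a
    deformation argument, the Poisson formula for log |1 - u| ([poisson_ln_1B]). *)

Section complex_modulus.
Variable R : realType.
Local Notation C := R[i].
Implicit Types z w : C.

Lemma cabsE z : (cabs z)%:C%C = `|z|.
Proof. by rewrite [RHS]normc_def. Qed.

Lemma cabs_ge0 z : 0 <= cabs z.
Proof. exact: sqrtr_ge0. Qed.

Lemma sqr_cabs z : cabs z ^+ 2 = complex.Re z ^+ 2 + complex.Im z ^+ 2.
Proof. by rewrite sqr_sqrtr ?addr_ge0 ?sqr_ge0. Qed.

Lemma cabsM z w : cabs (z * w) = cabs z * cabs w.
Proof. by apply: (@complexI R); rewrite rmorphM/= !cabsE normrM. Qed.

Lemma cabsV z : cabs z^-1 = (cabs z)^-1.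
Proof. by apply: (@complexI R); rewrite fmorphV/= !cabsE normfV. Qed.

Lemma cabsN z : cabs (- z) = cabs z.
Proof. by apply: (@complexI R); rewrite !cabsE normrN. Qed.

Lemma cabsB z w : cabs (z - w) = cabs (w - z).
Proof. by rewrite -cabsN opprB. Qed.

Lemma cabs0 : cabs (0 : C) = 0.
Proof. by apply: (@complexI R); rewrite cabsE normr0. Qed.

Lemma cabs1 : cabs (1 : C) = 1.
Proof. by apply: (@complexI R); rewrite cabsE normr1. Qed.

Lemma cabs_eq0 z : (cabs z == 0) = (z == 0).
Proof. by rewrite -[RHS]normr_eq0 -cabsE (inj_eq (@complexI R) _ 0). Qed.

Lemma cabs_gt0 z : (0 < cabs z) = (z != 0).
Proof. by rewrite lt_neqAle cabs_ge0 andbT eq_sym cabs_eq0. Qed.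

Lemma cabsD z w : cabs (z + w) <= cabs z + cabs w.
Proof. by rewrite -lecR rmorphD/= !cabsE ler_normD. Qed.

Lemma cabsBD z w : cabs (z - w) <= cabs z + cabs w.
Proof. by rewrite -(cabsN w) cabsD. Qed.

Lemma cabs_sub_ge z w : cabs z - cabs w <= cabs (z - w).
Proof. by rewrite lerBlDr -{1}(subrK w z) cabsD. Qed.

Lemma cabsR (x : R) : cabs x%:C%C = `|x|.
Proof. by rewrite /cabs/= expr0n addr0 sqrtr_sqr. Qed.

Lemma cabsJ z : cabs (conjc z) = cabs z.
Proof. by apply: (@complexI R); rewrite !cabsE normcJ. Qed.

Lemma ReD z w : complex.Re (z + w) = complex.Re z + complex.Re w.
Proof. by case: z; case: w. Qed.

Lemma ReN z : complex.Re (- z) = - complex.Re z.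
Proof. by case: z. Qed.

Lemma ReB z w : complex.Re (z - w) = complex.Re z - complex.Re w.
Proof. by case: z; case: w. Qed.

Lemma ReZ (x : R) z : complex.Re (x%:C%C * z) = x * complex.Re z.
Proof. by case: z => a b /=; rewrite mul0r subr0. Qed.

Lemma Re_le_cabs z : `|complex.Re z| <= cabs z.
Proof. by rewrite -lecR cabsE; exact: normc_ge_Re. Qed.

Lemma Re_le z : complex.Re z <= cabs z.
Proof. exact: le_trans (ler_norm _) (Re_le_cabs z). Qed.

Lemma mulJc z : z * conjc z = (cabs z ^+ 2)%:C%C.
Proof. by rewrite -sqr_normc -cabsE rmorphXn. Qed.

Lemma conjM z w : conjc (z * w) = conjc z * conjc w.
Proof. exact: rmorphM. Qed.

Lemma conjB z w : conjc (z - w) = conjc z - conjc w.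
Proof. exact: rmorphB. Qed.

Lemma ReJ z : complex.Re (conjc z) = complex.Re z.
Proof. by case: z. Qed.

Lemma cabs_expi (t : R) : cabs (expi t) = 1.
Proof. by rewrite /cabs/= cos2Dsin2 sqrtr1. Qed.

Lemma expi_neq0 (t : R) : expi t != 0.
Proof. by rewrite -cabs_gt0 cabs_expi. Qed.

Lemma expiJ (t : R) : conjc (expi t) = (expi t)^-1.
Proof.
apply: (mulfI (expi_neq0 t)); rewrite mulJc cabs_expi expr1n.
by rewrite mulfV ?expi_neq0.
Qed.

End complex_modulus.

(** * Differentiation rules in Caratheodory form *)

Section caratheodory_derivative.
Variable K : numFieldType.
Implicit Types (f g q : K -> K) (z : K).

Definition kcont f z : Prop := f x @[x --> z] --> f z.

Lemma kcontP f z : kcont f z <->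
  (forall e : K, 0 < e -> exists2 d : K, 0 < d &
    forall w, `|w - z| < d -> `|f w - f z| < e).
Proof.
split=> [/cvgrPdist_lt fz e /fz/nbhs_ballP[d d0 h]|fz].
  by exists d => // w wz; rewrite distrC; apply: h; rewrite /ball/= distrC.
have zF := @nbhs_filter K z; apply/cvgrPdist_lt => e /fz[d d0 h]; apply/nbhs_ballP; exists d => // w.
by rewrite /ball/= distrC => /h; rewrite distrC.
Qed.

Lemma kcont_cst (c : K) z : kcont (fun=> c) z.
Proof. have zF := @nbhs_filter K z; exact: cvg_cst. Qed.

Lemma kcont_id z : kcont id z.
Proof. have zF := @nbhs_filter K z; exact: cvg_id. Qed.

Lemma kcontD f g z : kcont f z -> kcont g z -> kcont (fun x => f x + g x) z.
Proof. have zF := @nbhs_filter K z; exact: cvgD. Qed.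

Lemma kcontN f z : kcont f z -> kcont (fun x => - f x) z.
Proof. have zF := @nbhs_filter K z; exact: cvgN. Qed.

Lemma kcontM f g z : kcont f z -> kcont g z -> kcont (fun x => f x * g x) z.
Proof. have zF := @nbhs_filter K z; exact: cvgM. Qed.

Lemma kcontV f z : f z != 0 -> kcont f z -> kcont (fun x => (f x)^-1) z.
Proof. by have zF := @nbhs_filter K z; move=> ? ?; exact: cvgV. Qed.

Lemma kcont_comp f g z : kcont f z -> kcont g (f z) -> kcont (fun x => g (f x)) z.
Proof. by move=> fz gz; exact: (cvg_comp _ _ fz gz). Qed.

(** Caratheodory's form of the derivative: the difference quotient extends continuously to [z]. The
    calculus rules become algebraic identities, and the continuous quotient [q] is itself used in
    [poisson_formula]. *)
Definition kderiv f z (d : K) : Prop :=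
  exists q, [/\ kcont q z, q z = d & forall w, f w - f z = q w * (w - z)].

Lemma kderiv_cont f z d : kderiv f z d -> kcont f z.
Proof.
move=> [q [qz _ fq]]; have fE w : f w = q w * (w - z) + f z.
  by rewrite -fq subrK.
rewrite (funext fE); apply: kcontD; last exact: kcont_cst; apply: kcontM => //.
by apply: kcontD; [exact: kcont_id|exact: kcont_cst].
Qed.

Lemma kderiv_cst (c : K) z : kderiv (fun=> c) z 0.
Proof.
by exists (fun=> 0); split=> [||w]; [exact: kcont_cst| |rewrite subrr mul0r].
Qed.

Lemma kderiv_id z : kderiv id z 1.
Proof. by exists (fun=> 1); split=> [||w]; [exact: kcont_cst| |rewrite mul1r]. Qed.

Lemma kderivD f g z a b : kderiv f z a -> kderiv g z b ->
  kderiv (fun x => f x + g x) z (a + b).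
Proof.
move=> [q [qz <- fq]] [p [pz <- gp]]; exists (fun w => q w + p w).
by split=> [||w] //; [exact: kcontD|rewrite opprD addrACA fq gp mulrDl].
Qed.

Lemma kderivM f g z a b : kderiv f z a -> kderiv g z b ->
  kderiv (fun x => f x * g x) z (a * g z + f z * b).
Proof.
move=> fa gb; have gz := kderiv_cont gb; move: fa gb.
move=> [q [qz <- fq]] [p [pz <- gp]]; exists (fun w => q w * g w + f z * p w).
split=> [||w] //.
  by apply: kcontD; apply: kcontM => //; exact: kcont_cst.
have -> : f w * g w - f z * g z = (f w - f z) * g w + f z * (g w - g z) by ring.
by rewrite fq gp; ring.
Qed.

Lemma kcont_near f g z (r : K) : 0 < r ->
  (forall w, `|w - z| < r -> f w = g w) -> kcont f z -> kcont g z.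
Proof.
move=> r0 fg; have fgz : f z = g z by apply: fg; rewrite subrr normr0.
have nfg : nbhs z [set w | f w = g w].
  by apply/nbhs_ballP; exists r => // w; rewrite /ball/= distrC => /fg.
rewrite /kcont -fgz => fz; apply: cvg_trans fz.
by have zF := @nbhs_filter K z; apply: near_eq_cvg.
Qed.

Lemma kderivV f z a : f z != 0 -> kderiv f z a ->
  kderiv (fun x => (f x)^-1) z (- a / f z ^+ 2).
Proof.
move=> f0 fa; have fz := kderiv_cont fa; move: fa => [q [qz <- fq]].
(* Since [0^-1 = 0], the increment equals [- (f z)^-1] wherever [f w = 0], and the factor must
   account for it. Near [z] this case does not occur. *)
exists (fun w => if f w == 0 then - (f z)^-1 / (w - z)
                 else - q w * ((f w)^-1 * (f z)^-1)).
have /kcontP := fz => /(_ `|f z|); rewrite normr_gt0 => /(_ f0) [d d0 hd].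
split=> [||w] //.
- apply: (@kcont_near (fun w => - q w * ((f w)^-1 * (f z)^-1)) _ _ _ d0).
    by move=> w /hd; have [->|//] := eqVneq (f w) 0; rewrite sub0r normrN ltxx.
  apply: kcontM; first exact: kcontN.
  by apply: kcontM; [exact: kcontV|exact: kcont_cst].
- by rewrite (negbTE f0) expr2 invfM.
- have [fw|fw] := eqVneq (f w) 0.
    rewrite fw invr0 sub0r divfK// subr_eq0; apply: contraNneq f0 => <-.
    exact/eqP.
  rewrite -(mulrC (w - z)) !mulrA mulrN -(mulrC (q w)) -fq; field.
  by rewrite f0 fw.
Qed.

Lemma kderiv_comp f g z a b : kderiv f z a -> kderiv g (f z) b ->
  kderiv (fun x => g (f x)) z (b * a).
Proof.
move=> fa; have fz := kderiv_cont fa; move: fa => [q [qz <- fq]] [p [pz <- gp]].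
exists (fun w => p (f w) * q w).
split=> [||w] //; last by rewrite gp fq mulrA.
by apply: kcontM => //; exact: kcont_comp.
Qed.

Lemma kderiv_near f g z d (r : K) : 0 < r ->
  (forall w, `|w - z| < r -> f w = g w) -> kderiv f z d -> kderiv g z d.
Proof.
move=> r0 fg [q [qz qd fq]].
have fgz : f z = g z by apply: fg; rewrite subrr normr0.
(* Away from [z] the functions may differ, so the factor is the quotient of [g] itself, with [d]
   replacing the default value of a division by zero at [z]. *)
exists (fun w => if w == z then d else (g w - g z) / (w - z)); split.
- apply: kcont_near r0 _ qz => w /fg e.
  have [->//|wz] := eqVneq w z.
  by rewrite -fgz -e fq mulfK// subr_eq0.
- by rewrite eqxx.
- move=> w; have [->|wz] := eqVneq w z; first by rewrite !subrr mulr0.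
  by rewrite divfK// subr_eq0.
Qed.

End caratheodory_derivative.

Section cderiv_rules.
Variable R : realType.
Local Notation C := R[i].
Implicit Types (f g : C -> C) (z : C).

Definition ccont f z := forall eps : R, 0 < eps ->
  exists2 delta : R, 0 < delta & forall w : C, cabs (w - z) < delta ->
    cabs (f w - f z) < eps.

Lemma posC (e : C) : 0 < e -> e = (complex.Re e)%:C%C /\ 0 < complex.Re e.
Proof. by case: e => a b; rewrite ltcE/= => /andP[/eqP -> ?]. Qed.

Lemma ccontE f z : ccont f z <-> @kcont C f z.
Proof.
rewrite kcontP; split=> h e e0.
  have [eE e1] := posC e0; have [d d0 hd] := h _ e1.
  exists d%:C%C; first by rewrite ltcR.
  by move=> w; rewrite eE -!cabsE !ltcR => /hd.
have [|d d0 hd] := h e%:C%C; first by rewrite ltcR.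
have [dE d1] := posC d0; exists (complex.Re d) => // w wz.
by rewrite -ltcR cabsE hd// dE -cabsE ltcR.
Qed.

Lemma has_cderivE f z d : has_cderiv f z d <-> @kderiv C f z d.
Proof.
split=> [h|[q [/ccontE qz <- fq]] e e0].
  exists (fun w => if w == z then d else (f w - f z) / (w - z)); split.
  - apply/ccontE => e e0; have [|del [d0 hd]] := h (e / 2); first by lra.
    exists del => // w wz; rewrite eqxx.
    have [_|nwz] := eqVneq w z; first by rewrite subrr cabs0.
    apply: le_lt_trans (hd w _) _; last by lra.
    by rewrite cabs_gt0 subr_eq0 nwz.
  - by rewrite eqxx.
  - move=> w; have [->|wz] := eqVneq w z; first by rewrite !subrr mulr0.
    by rewrite divfK// subr_eq0.
have [del d0 hd] := qz _ e0; exists del; split=> // w /andP[wz0 wz].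
by rewrite fq mulfK ?ltW ?hd// -cabs_gt0.
Qed.

End cderiv_rules.

(** * Goursat's theorem on rectangles *)

Section segment_integral.
Variable R : realType.
Implicit Types (f g : R -> R) (a b c : R).

Definition sint f a b : R := Rintegral (@lebesgue_measure R) `[a, b] f.

(** Two-sided continuity in [R], endpoints included, rather than continuity of the restriction: the
    usual rules then apply pointwise, without subspace topologies. *)
Definition cont_on f a b := forall x, a <= x <= b -> {for x, continuous f}.

Lemma cont_on_integrable f a b : cont_on f a b ->
  (@lebesgue_measure R).-integrable `[a, b] (EFin \o f).
Proof.
move=> fab; apply: continuous_compact_integrable; first exact: segment_compact.
by apply: continuous_in_subspaceT => x; rewrite inE/= in_itv/= => /fab.
Qed.

Lemma cont_onS f a b a' b' : a <= a' -> b' <= b -> cont_on f a b ->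
  cont_on f a' b'.
Proof. by move=> aa bb fab x /andP[ax xb]; apply: fab; apply/andP; split; lra. Qed.

Lemma sint_split f a b c : a <= c -> c <= b -> cont_on f a b ->
  sint f a b = sint f a c + sint f c b.
Proof.
move=> ac cb fab; have fi := cont_on_integrable fab.
have := @Rintegral_itvB R f (BLeft a) (BRight b) c fi.
rewrite !bnd_simp => /(_ ac cb).
rewrite Rintegral_itv_obnd_cbnd.
  by rewrite /sint => <-; rewrite addrC subrK.
by apply: integrableS fi => //; apply: subset_itvr; rewrite bnd_simp.
Qed.

Lemma sintB f g a b : cont_on f a b -> cont_on g a b ->
  sint (fun x => f x - g x) a b = sint f a b - sint g a b.
Proof. by move=> ? ?; apply: RintegralB => //; exact: cont_on_integrable. Qed.

Lemma sintD f g a b : cont_on f a b -> cont_on g a b ->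
  sint (fun x => f x + g x) a b = sint f a b + sint g a b.
Proof. by move=> ? ?; apply: RintegralD => //; exact: cont_on_integrable. Qed.

Lemma sintZ (r : R) f a b : cont_on f a b ->
  sint (fun x => r * f x) a b = r * sint f a b.
Proof. by move=> ?; apply: RintegralZl => //; exact: cont_on_integrable. Qed.

Lemma sint_cst (r : R) a b : a <= b -> sint (fun=> r) a b = r * (b - a).
Proof.
move=> ab; rewrite /sint Rintegral_cst//= lebesgue_measure_itv/= lte_fin.
have [//|ba] := ltP a b.
by have -> : a = b; [lra|rewrite subrr].
Qed.

Lemma cont_on_cst (r : R) a b : cont_on (fun=> r) a b.
Proof. by move=> x _; exact: cvg_cst. Qed.

Lemma cont_onD f g a b : cont_on f a b -> cont_on g a b ->
  cont_on (fun x => f x + g x) a b.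
Proof. by move=> fab gab x xab; apply: cvgD; [exact: fab|exact: gab]. Qed.

Lemma cont_onB f g a b : cont_on f a b -> cont_on g a b ->
  cont_on (fun x => f x - g x) a b.
Proof. by move=> fab gab x xab; apply: cvgB; [exact: fab|exact: gab]. Qed.

Lemma cont_onM f g a b : cont_on f a b -> cont_on g a b ->
  cont_on (fun x => f x * g x) a b.
Proof. by move=> fab gab x xab; apply: cvgM; [exact: fab|exact: gab]. Qed.

Lemma le_sint f g a b : cont_on f a b -> cont_on g a b ->
  (forall x, a <= x <= b -> f x <= g x) -> sint f a b <= sint g a b.
Proof.
move=> fab gab fg; apply: le_Rintegral => //; exact: cont_on_integrable.
Qed.

Lemma eq_sint f g a b : (forall x, a <= x <= b -> f x = g x) ->
  sint f a b = sint g a b.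
Proof.
by move=> fg; apply: eq_Rintegral => x; rewrite inE/= in_itv/=; exact: fg.
Qed.

Lemma sint_near_cst f (m k : R) a b : a <= b -> cont_on f a b ->
  (forall x, a <= x <= b -> `|f x - m| <= k) ->
  `|sint f a b - m * (b - a)| <= k * (b - a).
Proof.
move=> ab fab fm; have c r : cont_on (fun=> r) a b by exact: cont_on_cst.
rewrite ler_distl -!(sint_cst _ ab) -(sintB (c _) (c _)) -(sintD (c _) (c _)).
apply/andP; split; apply: le_sint => //; try exact: cont_on_cst;
  by move=> x /fm; rewrite ler_distl => /andP[].
Qed.

End segment_integral.

Section rectangle_goursat.
Variable R : realType.
Variables P Q : R -> R -> R.

Definition frechet_at (F : R -> R -> R) (s t a b : R) := forall e : R, 0 < e ->
  exists2 d : R, 0 < d & forall s' t', `|s' - s| < d -> `|t' - t| < d ->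
    `|F s' t' - F s t - a * (s' - s) - b * (t' - t)| <=
      e * (`|s' - s| + `|t' - t|).

(* the form [P ds + Q dt] is differentiable and closed at [(s, t)] *)
Definition closed_at (s t : R) := exists a b c,
  frechet_at P s t a b /\ frechet_at Q s t b c.

Lemma frechet_cont1 F s t a b : frechet_at F s t a b ->
  {for s, continuous (fun x => F x t)}.
Proof.
move=> h; apply/cvgrPdist_le => e e0; have [d d0 hd] := h 1 ltr01.
have a0 : 0 < 1 + `|a| by rewrite ltr_pwDl.
apply/nbhs_ballP; exists (Num.min d (e / (1 + `|a|))).
  by rewrite /= lt_min d0 divr_gt0.
move=> x; rewrite /ball/= distrC lt_min => /andP[xd xe].
have := hd x t xd; rewrite subrr normr0 mulr0 subr0 addr0 mul1r => /(_ d0) h1.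
move: xe; rewrite ltr_pdivlMr// => xe; rewrite distrC.
have : `|F x t - F s t| <= `|x - s| + `|a * (x - s)|.
  by rewrite -{1}(subrK (a * (x - s)) (F x t - F s t)) (le_trans (ler_normD _ _))// lerD2r.
by rewrite normrM; nra.
Qed.

Lemma frechet_cont2 F s t a b : frechet_at F s t a b ->
  {for t, continuous (F s)}.
Proof.
move=> h; apply: (@frechet_cont1 (fun x y => F y x) t s b a).
move=> e /h[d d0 hd]; exists d => // s' t' h1 h2.
by have := hd _ _ h2 h1; rewrite addrAC [X in _ <= _ * X]addrC.
Qed.

Variables (s1 t1 h0 k0 : R).
Hypotheses (h0_ge0 : 0 <= h0) (k0_ge0 : 0 <= k0).
Hypothesis closedPQ : forall s t, s1 <= s <= s1 + h0 -> t1 <= t <= t1 + k0 ->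
  closed_at s t.

Let contP t : t1 <= t <= t1 + k0 -> cont_on (fun s => P s t) s1 (s1 + h0).
Proof. by move=> tk s sh; have [a [b [c [/frechet_cont1]]]] := closedPQ sh tk. Qed.

Let contQ s : s1 <= s <= s1 + h0 -> cont_on (Q s) t1 (t1 + k0).
Proof. by move=> sh t tk; have [a [b [c [_ /frechet_cont2]]]] := closedPQ sh tk. Qed.

Definition circulation (x y h k : R) : R :=
  (sint (fun s => P s y) x (x + h) - sint (fun s => P s (y + k)) x (x + h)) +
  (sint (Q (x + h)) y (y + k) - sint (Q x) y (y + k)).

Let inside (x y h k : R) := [/\ 0 <= h /\ 0 <= k,
  s1 <= x, t1 <= y, x + h <= s1 + h0 & y + k <= t1 + k0].

Let circulation_split x y h k : inside x y (h + h) (k + k) -> 0 <= h -> 0 <= k ->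
  circulation x y (h + h) (k + k) =
  circulation x y h k + circulation (x + h) y h k +
  circulation x (y + k) h k + circulation (x + h) (y + k) h k.
Proof.
move=> [[hh kk] sx ty xs yt] h_ge0 k_ge0; rewrite /circulation.
have cP t : t1 <= t <= t1 + k0 ->
    sint (fun s => P s t) x (x + (h + h)) = sint (fun s => P s t) x (x + h) +
      sint (fun s => P s t) (x + h) (x + h + h).
  move=> /contP c; rewrite addrA; apply: sint_split; [lra|lra|].
  by apply: cont_onS c; lra.
have cQ s : s1 <= s <= s1 + h0 ->
    sint (Q s) y (y + (k + k)) = sint (Q s) y (y + k) +
      sint (Q s) (y + k) (y + k + k).
  move=> /contQ c; rewrite addrA; apply: sint_split; [lra|lra|].
  by apply: cont_onS c; lra.
rewrite !cP ?cQ; try (apply/andP; split; lra).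
rewrite !addrA; ring.
Qed.

(** The affine part of the form has no circulation, because [P] and [Q] share the mixed coefficient
    [b]. The remainder is at most [e / 2 * (h + k)] on the rectangle, so each pair of opposite sides
    costs at most [e * (h + k)] times their length. *)
Let circulation_small s t : s1 <= s <= s1 + h0 -> t1 <= t <= t1 + k0 ->
  forall e, 0 < e -> exists2 d, 0 < d & forall x y h k, inside x y h k ->
    x <= s <= x + h -> y <= t <= y + k -> h < d -> k < d ->
    `|circulation x y h k| <= e * (h + k) ^+ 2.
Proof.
move=> sh tk e e0; have [a [b [c [dP dQ]]]] := closedPQ sh tk.
have e2 : 0 < e / 2 by lra.
have [d1 d10 hP] := dP _ e2; have [d2 d20 hQ] := dQ _ e2.
exists (Num.min d1 d2); first by rewrite lt_min d10.
move=> x y h k [[h_ge0 k_ge0] sx ty xs yt] /andP[xs' sx'] /andP[yt' ty'].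
rewrite !lt_min => /andP[hd1 hd2] /andP[kd1 kd2].
have nearP u : x <= u <= x + h -> `|u - s| <= h.
  by move=> /andP[? ?]; rewrite ler_norml; apply/andP; split; lra.
have nearQ u : y <= u <= y + k -> `|u - t| <= k.
  by move=> /andP[? ?]; rewrite ler_norml; apply/andP; split; lra.
have cP v : y <= v <= y + k -> cont_on (fun s => P s v) x (x + h).
  move=> /andP[? ?]; have /contP c' : t1 <= v <= t1 + k0 by apply/andP; split; lra.
  by apply: cont_onS c'; lra.
have cQ u : x <= u <= x + h -> cont_on (Q u) y (y + k).
  move=> /andP[? ?]; have /contQ c' : s1 <= u <= s1 + h0 by apply/andP; split; lra.
  by apply: cont_onS c'; lra.
have yy : y <= y <= y + k by apply/andP; split; lra.
have yk : y <= y + k <= y + k by apply/andP; split; lra.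
have xx : x <= x <= x + h by apply/andP; split; lra.
have xh : x <= x + h <= x + h by apply/andP; split; lra.
have estP u v : x <= u <= x + h -> y <= v <= y + k ->
    `|P u v - P s t - a * (u - s) - b * (v - t)| <= e / 2 * (h + k).
  move=> /nearP uh /nearQ vk; apply: le_trans (hP u v _ _) _; [lra|lra|].
  by rewrite ler_pM2l// lerD.
have estQ u v : x <= u <= x + h -> y <= v <= y + k ->
    `|Q u v - Q s t - b * (u - s) - c * (v - t)| <= e / 2 * (h + k).
  move=> /nearP uh /nearQ vk; apply: le_trans (hQ u v _ _) _; [lra|lra|].
  by rewrite ler_pM2l// lerD.
rewrite /circulation -sintB; [|exact: cP|exact: cP].
rewrite -sintB; [|exact: cQ|exact: cQ].
have H1 := @sint_near_cst R (fun u => P u y - P u (y + k)) (- b * k)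
  (e * (h + k)) x (x + h).
have H2 := @sint_near_cst R (fun v => Q (x + h) v - Q x v) (b * h)
  (e * (h + k)) y (y + k).
move: H1 H2; rewrite (addrAC x) subrr add0r (addrAC y) subrr add0r => H1 H2.
have {}H1 : `|sint (fun u => P u y - P u (y + k)) x (x + h) - - b * k * h| <=
    e * (h + k) * h.
  apply: H1 => [||u uh]; first lra; first by apply: cont_onB; exact: cP.
  have := estP u y uh yy; have := estP u (y + k) uh yk.
  by rewrite !ler_norml => /andP[? ?] /andP[? ?]; apply/andP; split; nra.
have {}H2 : `|sint (fun v => Q (x + h) v - Q x v) y (y + k) - b * h * k| <=
    e * (h + k) * k.
  apply: H2 => [||v vk]; first lra; first by apply: cont_onB; exact: cQ.
  have := estQ _ v xh vk; have := estQ _ v xx vk.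
  by rewrite !ler_norml => /andP[? ?] /andP[? ?]; apply/andP; split; nra.
move: H1 H2; rewrite !ler_norml => /andP[? ?] /andP[? ?].
by apply/andP; split; nra.
Qed.

Let ord (n : nat) (p q : R * R) :=
  [/\ p.1 <= q.1, p.2 <= q.2, q.1 + h0 / 2 ^+ n.+1 <= p.1 + h0 / 2 ^+ n &
      q.2 + k0 / 2 ^+ n.+1 <= p.2 + k0 / 2 ^+ n].

Let bad (kappa : R) (n : nat) (p : R * R) :=
  inside p.1 p.2 (h0 / 2 ^+ n) (k0 / 2 ^+ n) /\
  kappa / 4 ^+ n <= `|circulation p.1 p.2 (h0 / 2 ^+ n) (k0 / 2 ^+ n)|.

(** The circulations of the four quarters add up to that of the rectangle, so one quarter carries at
    least a fourth of it. *)
Let bisect (kappa : R) n p : bad kappa n p -> exists2 q, bad kappa n.+1 q & ord n p q.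
Proof.
case: p => x y [/=]; rewrite /bad /ord /=.
have halve (r : R) : r / 2 ^+ n = r / 2 ^+ n.+1 + r / 2 ^+ n.+1.
  have : 0 < 2 ^+ n :> R by rewrite exprn_gt0.
  by rewrite exprS => ?; field; lra.
have kE : kappa / 4 ^+ n = 4 * (kappa / 4 ^+ n.+1).
  have : 0 < 4 ^+ n :> R by rewrite exprn_gt0.
  by rewrite exprS => ?; field; lra.
have h'0 : 0 <= h0 / 2 ^+ n.+1 by rewrite divr_ge0// exprn_ge0.
have k'0 : 0 <= k0 / 2 ^+ n.+1 by rewrite divr_ge0// exprn_ge0.
rewrite !halve kE; set h := h0 / _ in h'0 *; set k := k0 / _ in k'0 *; set K := kappa / _.
move=> ins; rewrite circulation_split//; case: ins => [[_ _] sx ty xs yt] big.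
have [b1|b1] := leP K `|circulation x y h k|.
  by exists (x, y) => /=; do ?split => //=; lra.
have [b2|b2] := leP K `|circulation (x + h) y h k|.
  by exists (x + h, y) => /=; do ?split => //=; lra.
have [b3|b3] := leP K `|circulation x (y + k) h k|.
  by exists (x, y + k) => /=; do ?split => //=; lra.
have [b4|b4] := leP K `|circulation (x + h) (y + k) h k|.
  by exists (x + h, y + k) => /=; do ?split => //=; lra.
move: big; set A := circulation x y h k; set B := circulation (x + h) y h k.
set D := circulation x (y + k) h k; set E := circulation (x + h) (y + k) h k.
have := ler_normD (A + B + D) E; have := ler_normD (A + B) D.
have := ler_normD A B; rewrite -/A -/B -/D -/E in b1 b2 b3 b4 *; lra.
Qed.

(** Goursat's bisection: a nonzero circulation [kappa] yields nested rectangles with circulation at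
    least kappa / 4^n around a common point, where [circulation_small] forces a smaller multiple of
    4^-n. *)
Lemma rectangle_goursat : circulation s1 t1 h0 k0 = 0.
Proof.
apply/eqP; rewrite -normr_eq0; apply/negP => /negP nz.
set kappa := `|circulation s1 t1 h0 k0| in nz.
have kappa0 : 0 < kappa by rewrite lt_neqAle eq_sym nz normr_ge0.
have bad0 : bad kappa 0 (s1, t1).
  by rewrite /bad /= !expr0 !divr1; split=> //; split => //=; lra.
have [g gbad gord] : exists2 g : nat -> R * R,
    (forall n, bad kappa n (g n)) & (forall n, ord n (g n) (g n.+1)).
  (* Dependent choice: the recursion carries the proof of [bad] along, since [bisect] needs it to
     produce the next corner. *)
  pose next (x : {np : nat * (R * R) | bad kappa np.1 np.2}) :=
    let: exist (n, p) b := x in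
    let: q := sval (cid2 (bisect b)) in q.
  have nextP n p (b : bad kappa n p) :
      bad kappa n.+1 (next (exist _ (n, p) b)) /\ ord n p (next (exist _ (n, p) b)).
    by rewrite /next; case: cid2 => q /= ? ?.
  pose G := fix G n : {p | bad kappa n p} := if n is m.+1 then
    exist _ (next (exist _ (m, sval (G m)) (svalP (G m)))) (nextP _ _ (svalP (G m))).1
    else exist _ (s1, t1) bad0.
  exists (fun n => sval (G n)) => n; first exact: (svalP (G n)).
  exact: (nextP _ _ (svalP (G n))).2.
have mono m n : (m <= n)%N -> [/\ (g m).1 <= (g n).1, (g m).2 <= (g n).2,
    (g n).1 + h0 / 2 ^+ n <= (g m).1 + h0 / 2 ^+ m &
    (g n).2 + k0 / 2 ^+ n <= (g m).2 + k0 / 2 ^+ m].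
  elim: n => [|n IH]; first by rewrite leqn0 => /eqP ->.
  rewrite leq_eqVlt => /predU1P[->//|]; rewrite ltnS => /IH[? ? ? ?].
  by have [? ? ? ?] := gord n; split; lra.
have pow_ge0 (r : R) n : 0 <= r -> 0 <= r / 2 ^+ n.
  by move=> r0; rewrite divr_ge0// exprn_ge0.
have nested m n : (g m).1 <= (g n).1 + h0 / 2 ^+ n /\
    (g m).2 <= (g n).2 + k0 / 2 ^+ n.
  have := pow_ge0 h0 m h0_ge0; have := pow_ge0 k0 m k0_ge0.
  have := pow_ge0 h0 n h0_ge0; have := pow_ge0 k0 n k0_ge0.
  by have [/mono[? ? ? ?]|/ltnW/mono[? ? ? ?]] := leqP m n; split; lra.
pose s := sup (range (fun n => (g n).1)); pose t := sup (range (fun n => (g n).2)).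
have hs n : (g n).1 <= s <= (g n).1 + h0 / 2 ^+ n.
  apply/andP; split.
    apply: ub_le_sup; last by exists n.
    by exists ((g 0).1 + h0 / 2 ^+ 0) => _ [m _ <-]; case: (nested m 0%N).
  apply: ge_sup; first by exists (g 0).1, 0%N.
  by move=> _ [m _ <-]; case: (nested m n).
have ht n : (g n).2 <= t <= (g n).2 + k0 / 2 ^+ n.
  apply/andP; split.
    apply: ub_le_sup; last by exists n.
    by exists ((g 0).2 + k0 / 2 ^+ 0) => _ [m _ <-]; case: (nested m 0%N).
  apply: ge_sup; first by exists (g 0).2, 0%N.
  by move=> _ [m _ <-]; case: (nested m n).
have sh : s1 <= s <= s1 + h0.
  by have := hs 0%N; move: (gbad 0%N) => [[_ ? _ ? _] _]; lra.
have tk : t1 <= t <= t1 + k0.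
  by have := ht 0%N; move: (gbad 0%N) => [[_ _ ? _ ?] _]; lra.
(* With this [e], the bound e (h0 + k0)^2 / 4^n stays below kappa / 4^n; the [+ 1] keeps the
   denominator positive for a degenerate rectangle. *)
pose e := kappa / (2 * (h0 + k0 + 1) ^+ 2).
have hk1 : 0 < h0 + k0 + 1 by lra.
have e0 : 0 < e by rewrite divr_gt0// mulr_gt0// exprn_gt0.
have [d d0 hd] := circulation_small sh tk e0.
have [n hn] : exists n : nat, (h0 + k0) / 2 ^+ n < d.
  have [n hn] : exists n : nat, (h0 + k0) / d < n%:R.
    by exists (Num.truncn ((h0 + k0) / d)).+1; rewrite truncnS_gt.
  exists n; rewrite ltr_pdivrMr ?exprn_gt0// mulrC -ltr_pdivrMr//.
  by apply: lt_le_trans hn _; rewrite -natrX ler_nat ltnW// ltn_expl.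
have [ins big] := gbad n.
have pn : 0 < 2 ^+ n :> R by rewrite exprn_gt0.
have hhk : (h0 + k0) / 2 ^+ n = h0 / 2 ^+ n + k0 / 2 ^+ n by rewrite mulrDl.
have := hd _ _ _ _ ins (hs n) (ht n).
have := pow_ge0 h0 n h0_ge0; have := pow_ge0 k0 n k0_ge0 => ? ?.
have hd' : h0 / 2 ^+ n < d /\ k0 / 2 ^+ n < d by split; lra.
move=> /(_ hd'.1 hd'.2); apply/negP; rewrite -ltNge.
apply: lt_le_trans big; rewrite -hhk exprMn -exprVn -!exprM mulnC exprM.
have -> : 2^-1 ^+ 2 = 4^-1 :> R by field.
rewrite exprVn mulrA ltr_pM2r ?invr_gt0 ?exprn_gt0// /e mulrAC.
by rewrite ltr_pdivrMr ?mulr_gt0 ?exprn_gt0// ltr_pM2l//; nra.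
Qed.

End rectangle_goursat.

(** * The complex exponential and its derivative *)

Section complex_exponential.
Variable R : realType.
Local Notation C := R[i].

Definition cexp (z : C) : C := (expR (complex.Re z))%:C%C * expi (complex.Im z).

Lemma is_derive1_lin0 (f : R -> R) (a : R) : is_derive (0 : R) 1 f a ->
  forall e, 0 < e -> exists2 d, 0 < d & forall y, `|y| < d ->
    `|f y - f 0 - a * y| <= e * `|y|.
Proof.
move=> /is_derive1_caratheodory[g [fg gx <-]] e e0.
have /cvgrPdist_lt/(_ _ e0)/nbhs_ballP[d d0 hd] := gx.
exists d => // y yx; have -> : f y - f 0 - g 0 * y = (g y - g 0) * y.
  by rewrite fg mulrBl; congr (_ * _ - _); ring.
rewrite normrM ler_wpM2r// ltW// distrC.
by apply: hd; rewrite /ball/= distrC; have -> : y - 0 = y by ring.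
Qed.

Lemma cabs_le_add (z : C) : cabs z <= `|complex.Re z| + `|complex.Im z|.
Proof.
rewrite -(@ler_pXn2r _ 2)// ?nnegrE ?cabs_ge0 ?addr_ge0//.
by rewrite sqr_cabs -(real_normK (num_real (complex.Re z)))
  -(real_normK (num_real (complex.Im z))); have := normr_ge0 (complex.Re z);
  have := normr_ge0 (complex.Im z); nra.
Qed.

Lemma Im_le_cabs (z : C) : `|complex.Im z| <= cabs z.
Proof.
rewrite -(@ler_pXn2r _ 2)// ?nnegrE ?cabs_ge0// real_normK ?num_real//.
by rewrite sqr_cabs lerDr sqr_ge0.
Qed.

Lemma cexpD (z w : C) : cexp (z + w) = cexp z * cexp w.
Proof.
case: z w => [a b] [c d]; rewrite /cexp /expi/= expRD cosD sinD.
by apply/eqP; rewrite eq_complex/=; apply/andP; split; apply/eqP; ring.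
Qed.

Lemma cabs_cexp (z : C) : cabs (cexp z) = expR (complex.Re z).
Proof. by rewrite /cexp cabsM cabsR cabs_expi mulr1 ger0_norm ?expR_ge0. Qed.

Lemma cexp0 : cexp 0 = 1.
Proof. by rewrite /cexp/= expR0 /expi cos0 sin0 mul1r. Qed.

Lemma has_cderiv_cexp0 : has_cderiv cexp 0 1.
Proof.
(* The real and imaginary parts of the error are at most 3 e' |w| and 4 e' |w|, whence the 7;
   [e' <= 1 / 2] keeps the real exponential below 2. *)
move=> e e0; pose e' := Num.min (e / 7) (1 / 2).
have e'0 : 0 < e' by rewrite lt_min; apply/andP; split; lra.
have e'1 : e' <= 1 / 2 by rewrite ge_min lexx orbT.
have e'e : e' * 7 <= e by rewrite -ler_pdivlMr// ge_min lexx.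
clearbody e'; have [d1 d10 h1] := is_derive1_lin0 (is_derive_expR (0 : R)) e'0.
have [d2 d20 h2] := is_derive1_lin0 (is_derive_cos (0 : R)) e'0.
have [d3 d30 h3] := is_derive1_lin0 (is_derive_sin (0 : R)) e'0.
exists (Num.min (Num.min d1 d2) (Num.min d3 e')); split.
  by rewrite !lt_min d10 d20 d30.
move=> w; rewrite subr0 !lt_min => /andP[w0 /andP[/andP[wd1 wd2] /andP[wd3 we]]].
have w1 : w != 0 by rewrite -cabs_gt0.
have xw := Re_le_cabs w; have yw := Im_le_cabs w.
have -> : (cexp w - cexp 0) / w - 1 = (cexp w - 1 - w) / w by rewrite cexp0; field.
rewrite cabsM cabsV ler_pdivrMr//; apply: le_trans (cabs_le_add _) _.
case: w w0 wd1 wd2 wd3 we w1 xw yw => x y /=.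
set c := cabs _ => c0 cd1 cd2 cd3 ce _ xc yc.
have := h1 x; have := h2 y; have := h3 y.
rewrite expR0 cos0 sin0 oppr0 !mul1r mul0r subr0 addr0.
move=> /(_ (le_lt_trans yc cd3)) {}h3 /(_ (le_lt_trans yc cd2)) {}h2.
move=> /(_ (le_lt_trans xc cd1)) {}h1.
rewrite !mul0r !subr0 !addr0.
set E := expR x in h1 *; set S := sin y in h3 *; set K := cos y in h2 *.
have -> : E * K - 1 - x = (E - 1 - x) + E * (K - 1) by ring.
have -> : E * S - y = (E - 1) * y + E * (S - y) by ring.
have x2 : `|x| <= 1 / 2 by lra.
have h1' : e' * `|x| <= 1 / 4 by have := normr_ge0 x; nra.
have E0 : 0 <= E by exact: expR_ge0.
have E2 : `|E| <= 2.
  by have := ler_norm (E - 1 - x); rewrite (ger0_norm E0);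
    have := ler_norm x; lra.
have E1 : `|E - 1| <= 2 * e'.
  have -> : E - 1 = (E - 1 - x) + x by ring.
  by apply: le_trans (ler_normD _ _) _; nra.
have A1 := ler_normD (E - 1 - x) (E * (K - 1)).
have A2 := ler_normD ((E - 1) * y) (E * (S - y)).
have B1 : `|E * (K - 1)| <= 2 * (e' * c).
  by rewrite normrM ler_pM// (le_trans h2)// ler_pM2l.
have B2 : `|E * (S - y)| <= 2 * (e' * c).
  by rewrite normrM ler_pM// (le_trans h3)// ler_pM2l.
have B3 : `|(E - 1) * y| <= 2 * e' * c by rewrite normrM ler_pM.
nra.
Qed.

Lemma has_cderiv_cexp (z : C) : has_cderiv cexp z (cexp z).
Proof.
have cexpE : cexp = fun w => cexp z * cexp (w - z).
  by apply/funext => w; rewrite -cexpD addrC subrK.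
apply/has_cderivE; rewrite {1}cexpE.
have d1 : kderiv (fun w : C => w - z) z (1 + 0).
  by apply: kderivD; [exact: kderiv_id|exact: kderiv_cst].
have := has_cderiv_cexp0; rewrite -(subrr z) => /has_cderivE /(kderiv_comp d1) d2.
have := kderivM (kderiv_cst (cexp z) z) d2.
by rewrite addr0 mul0r add0r !mulr1.
Qed.

End complex_exponential.

(** * Circle means and the Poisson formula *)

Section circle_means.
Variable R : realType.
Local Notation C := R[i].
Implicit Types G : C -> C.

Definition pol (rho t : R) : C := rho%:C%C * expi t.

Lemma cabs_pol rho t : 0 <= rho -> cabs (pol rho t) = rho.
Proof. by move=> r0; rewrite /pol cabsM cabsR cabs_expi mulr1 ger0_norm. Qed.

Lemma pol1 t : pol 1 t = expi t.
Proof. by rewrite /pol rmorph1 mul1r. Qed.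

Lemma pol0 t : pol 0 t = 0.
Proof. by rewrite /pol mul0r. Qed.

Lemma expi_cont (t0 e : R) : 0 < e -> exists2 d, 0 < d &
  forall t, `|t - t0| < d -> cabs (expi t - expi t0) < e.
Proof.
move=> e0; have e2 : 0 < e / 2 by lra.
have /cvgrPdist_lt/(_ _ e2)/nbhs_ballP[d1 d10 h1] := @continuous_cos R t0.
have /cvgrPdist_lt/(_ _ e2)/nbhs_ballP[d2 d20 h2] := @continuous_sin R t0.
exists (Num.min d1 d2) => [|t]; first by rewrite lt_min d10.
rewrite lt_min distrC => /andP[td1 td2]; apply: le_lt_trans (cabs_le_add _) _.
have := h1 _ td1; have := h2 _ td2; rewrite /= [`|cos t0 - _|]distrC.
by rewrite [`|sin t0 - _|]distrC; lra.
Qed.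

Lemma ccont_pol G rho0 t0 : ccont G (pol rho0 t0) -> forall e, 0 < e ->
  exists2 d, 0 < d & forall rho t, `|rho - rho0| < d -> `|t - t0| < d ->
    cabs (G (pol rho t) - G (pol rho0 t0)) < e.
Proof.
move=> cG e /cG[d d0 hd].
have r1 : 0 < `|rho0| + 1 by rewrite ltr_pwDr.
have [|d1 d10 h1] := @expi_cont t0 (d / 2 / (`|rho0| + 1)).
  by rewrite divr_gt0//; lra.
exists (Num.min (d / 2) d1) => [|rho t]; first by rewrite lt_min d10; lra.
rewrite !lt_min => /andP[rd _] /andP[_ /h1]; rewrite ltr_pdivlMr// => td.
apply: hd; have -> : pol rho t - pol rho0 t0 =
    (rho - rho0)%:C%C * expi t + rho0%:C%C * (expi t - expi t0).
  by rewrite /pol rmorphB; ring.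
apply: le_lt_trans (cabsD _ _) _; rewrite !cabsM !cabsR cabs_expi mulr1.
by have := cabs_ge0 (expi t - expi t0); nra.
Qed.

(** Not divided by [2 * pi], and restricted to real parts so that every integral stays
    real-valued. *)
Definition circle_mean G (rho : R) : R :=
  sint (fun t => complex.Re (G (pol rho t))) 0 (2 * pi).

Lemma ccont_pol_cont_on G rho a b : (forall t, ccont G (pol rho t)) ->
  cont_on (fun t => complex.Re (G (pol rho t))) a b.
Proof.
move=> cG t _; apply/cvgrPdist_lt => e /(ccont_pol (cG t))[d d0 hd].
apply/nbhs_ballP; exists d => // u; rewrite /ball/= distrC => ut.
rewrite distrC -ReB; apply: le_lt_trans (Re_le_cabs _) _.
by apply: hd => //; rewrite subrr normr0.
Qed.

Lemma twopi_ge0 : 0 <= 2 * pi :> R.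
Proof. by rewrite mulr_ge0// pi_ge0. Qed.

Variables (G : C -> C) (rad : R).
Hypothesis cG : forall w, cabs w < rad -> ccont G w.

Lemma circle_mean_cont (rho0 e : R) : 0 <= rho0 < rad -> 0 < e ->
  exists2 d, 0 < d & forall rho, 0 <= rho < rad -> `|rho - rho0| < d ->
    `|circle_mean G rho - circle_mean G rho0| <= e.
Proof.
move=> /andP[r0 rr] e0; have tp := @pi_gt0 R.
have e'0 : 0 < e / (2 * pi) by rewrite divr_gt0//; lra.
(* Compactness of the segment of angles makes the continuity in the radius uniform in the angle. *)
have /compact_near_coveringP := @segment_compact R 0 (2 * pi).
move=> /(_ R (nbhs rho0) (fun rho t =>
  cabs (G (pol rho t) - G (pol rho0 t)) < e / (2 * pi)) (nbhs_filter rho0)).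
case=> [t _|d d0 hd].
  have [||d d0 hd] := @ccont_pol G rho0 t _ (e / (2 * pi) / 2).
    by apply: cG; rewrite cabs_pol.
    lra.
  exists (ball t d, ball rho0 d); first by split; exact: nbhsx_ballx.
  move=> [u rho] /= [ut rhor].
  have h1 := hd rho u; rewrite distrC in h1; move: rhor => /h1.
  rewrite distrC => /(_ ut) {}h1.
  have h2 := hd rho0 u; rewrite subrr normr0 distrC in h2.
  have {}h2 := h2 d0 ut.
  have -> : G (pol rho u) - G (pol rho0 u) =
    (G (pol rho u) - G (pol rho0 t)) - (G (pol rho0 u) - G (pol rho0 t)) by ring.
  by apply: le_lt_trans (cabsBD _ _) _; lra.
exists d => // rho /andP[rho0' rhor] rd.
have cr r : 0 <= r -> r < rad ->
    cont_on (fun t => complex.Re (G (pol r t))) 0 (2 * pi).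
  by move=> ? ?; apply: ccont_pol_cont_on => t; apply: cG; rewrite cabs_pol.
rewrite /circle_mean -sintB; [|exact: cr|exact: cr].
have := @sint_near_cst R (fun t => complex.Re (G (pol rho t)) -
  complex.Re (G (pol rho0 t))) 0 (e / (2 * pi)) 0 (2 * pi) twopi_ge0.
rewrite mul0r !subr0 divfK ?gt_eqF ?mulr_gt0//; apply.
  by apply: cont_onB; exact: cr.
move=> t tp2; rewrite subr0 -ReB; apply: le_trans (Re_le_cabs _) _.
by apply/ltW/hd; rewrite /ball/= 1?distrC// in_itv.
Qed.

(** In logarithmic coordinates w = e^(s + it), with F = G(e^(s + it)), the form Im F ds + Re F dt is
    the imaginary part of F d(s + it), hence closed. Around the rectangle the sides t = 0 and t = 2
    pi cancel by periodicity, and what remains is the difference of the two circle integrals. *)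
Lemma circle_mean_const (r1 r2 : R) : 0 < r1 -> r1 <= r2 ->
  (forall w, r1 <= cabs w <= r2 -> exists d, has_cderiv G w d) ->
  circle_mean G r1 = circle_mean G r2.
Proof.
move=> r10 r12 dG; have r20 : 0 < r2 by lra.
pose F (s t : R) := G (cexp (s +i* t)%C).
have FE s t : F s t = G (pol (expR s) t) by [].
have s0 : 0 <= ln r2 - ln r1 by rewrite subr_ge0 ler_ln.
have frech s t D : has_cderiv (fun w => G (cexp w)) (s +i* t)%C D ->
    frechet_at (fun s t => complex.Re (F s t)) s t (complex.Re D) (- complex.Im D) /\
    frechet_at (fun s t => complex.Im (F s t)) s t (complex.Im D) (complex.Re D).
  move=> hD; have est e : 0 < e -> exists2 d, 0 < d & forall s' t',
      `|s' - s| < d -> `|t' - t| < d ->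
      cabs (F s' t' - F s t - D * ((s' - s) +i* (t' - t))%C) <=
        e * (`|s' - s| + `|t' - t|).
    move=> e0; have [d [d0 hd]] := hD _ e0; exists (d / 2) => [|s' t' sd td]; first lra.
    set h := ((s' - s) +i* (t' - t))%C.
    have hE : (s' +i* t')%C - (s +i* t)%C = h by [].
    have hs : cabs h <= `|s' - s| + `|t' - t| := cabs_le_add h.
    have [h0|h0] := eqVneq h 0.
      move: (hE); rewrite h0 => /subr0_eq[-> ->].
      by rewrite /F !subrr mulr0 subr0 cabs0 normr0 addr0 mulr0.
    have hd0 : 0 < cabs ((s' +i* t')%C - (s +i* t)%C) < d.
      by rewrite hE cabs_gt0 h0 (le_lt_trans hs)//; lra.
    have := hd _ hd0; rewrite hE -/(F s t) -/(F s' t').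
    have -> : (F s' t' - F s t) / h - D = (F s' t' - F s t - D * h) / h by field.
    rewrite cabsM cabsV ler_pdivrMr ?cabs_gt0// => /le_trans; apply.
    by rewrite ler_pM2l.
  split=> e /est[d d0 hd]; exists d => // s' t' sd td;
      apply: le_trans (hd _ _ sd td).
    apply: le_trans (Re_le_cabs _); rewrite !ReB; case: (D) => a b /=.
    by rewrite le_eqVlt; apply/orP; left; apply/eqP; congr `|_|; ring.
  apply: le_trans (Im_le_cabs _); case: (D) => a b.
  by case: (F s' t') => ? ?; case: (F s t) => ? ? /=; rewrite le_eqVlt; apply/orP; left; apply/eqP; congr `|_|; ring.
have := @rectangle_goursat R (fun s t => complex.Im (F s t))
  (fun s t => complex.Re (F s t)) (ln r1) 0 (ln r2 - ln r1) (2 * pi) s0 twopi_ge0.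
rewrite /circulation !add0r (addrC (ln r1)) subrK.
rewrite [X in X - _](_ : _ = sint (fun s => complex.Im (F s (2 * pi))) (ln r1) (ln r2)).
  rewrite subrr add0r /F /cexp /= !lnK ?posrE// => H.
  apply/esym/subr0_eq/H => s t /andP[s1 s2] _.
  have [|d hd] := dG (cexp (s +i* t)%C).
    by rewrite cabs_cexp -(ler_ln _ (expR_gt0 _))// -(ler_ln (expR_gt0 _))// expRK s1.
  have /has_cderivE/frech[h1 h2] :=
    kderiv_comp (iffLR (has_cderivE _ _ _) (has_cderiv_cexp (s +i* t)%C))
      (iffLR (has_cderivE _ _ _) hd).
  by do 3 eexists; split; [exact: h2|exact: h1].
apply: eq_sint => s _; rewrite /F /cexp /expi /=.
by rewrite -(add0r (2 * pi)) mulr_natl cosD2pi sinD2pi.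
Qed.

End circle_means.

Section mean_value_property.
Variable R : realType.
Local Notation C := R[i].
Implicit Types (f G : C -> C).

Lemma has_cderiv_ccont f z d : has_cderiv f z d -> ccont f z.
Proof. by move=> /has_cderivE/kderiv_cont/ccontE. Qed.

(** The exceptional point [p] is there for difference quotients filled in by continuity.
    [circle_mean_const] compares radii on the same side of |p|; continuity in the radius carries the
    value across |p| and down to radius 0. *)
Theorem mean_value G (rad : R) (p : C) : 1 < rad -> cabs p < 1 ->
  (forall w, cabs w < rad -> ccont G w) ->
  (forall w, cabs w < rad -> w != p -> exists d, has_cderiv G w d) ->
  circle_mean G 1 = complex.Re (G 0) * (2 * pi).
Proof.
move=> rad1 p1 cG dG.
have -> : complex.Re (G 0) * (2 * pi) = circle_mean G 0.
  rewrite /circle_mean (@eq_sint _ _ (fun=> complex.Re (G 0))) => [|t _].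
    by rewrite sint_cst ?twopi_ge0// subr0.
  by rewrite pol0.
have limE r0 c : 0 <= r0 -> r0 < rad -> (forall d, 0 < d -> exists r,
    [/\ 0 <= r, r < rad, `|r - r0| < d & circle_mean G r = c]) ->
    circle_mean G r0 = c.
  move=> r00 r0r h; apply/eqP; rewrite -subr_eq0 -normr_eq0; apply/negP => /negP nz.
  have e0 : 0 < `|circle_mean G r0 - c| / 2 by rewrite divr_gt0// lt_neqAle eq_sym nz/=.
  have r0P : 0 <= r0 < rad by rewrite r00.
  have [d d0 hd] := circle_mean_cont cG r0P e0.
  have [r [r_ge0 rr rd rc]] := h _ d0.
  by have := hd r; rewrite r_ge0 rr rc => /(_ isT rd); rewrite distrC; lra.
have constE r1 r2 : 0 < r1 -> r1 <= r2 -> r2 < rad ->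
    ~~ (r1 <= cabs p <= r2) -> circle_mean G r1 = circle_mean G r2.
  move=> r10 r12 r2r pn; apply: circle_mean_const => // w /andP[w1 w2].
  apply: dG; first exact: le_lt_trans r2r.
  by apply: contraNneq pn => <-; rewrite w1.
have ca := cabs_ge0 p.
have outer r : cabs p < r -> r <= 1 -> circle_mean G r = circle_mean G 1.
  move=> pr r1; apply: constE => //; first lra.
  by apply/negP => /andP[]; lra.
have atp : circle_mean G (cabs p) = circle_mean G 1.
  apply: limE => //; first lra.
  move=> d d0; exists (Num.min 1 (cabs p + d / 2)).
  have [h|h] := leP 1 (cabs p + d / 2); split => //; try lra.
    by rewrite ger0_norm; lra.
    by rewrite addrC addKr ger0_norm; lra.
    by apply: outer; lra.
rewrite -atp; have [->//|pn0] := eqVneq (cabs p) 0.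
have pgt0 : 0 < cabs p by rewrite lt_neqAle eq_sym pn0.
have inner r : 0 < r -> r < cabs p -> circle_mean G r = circle_mean G (cabs p / 2).
  move=> r0 rp; have [h|h] := leP r (cabs p / 2).
    by apply: constE => //; [lra|apply/negP => /andP[]; lra].
  by apply/esym/constE; [lra|lra|lra|apply/negP => /andP[]; lra].
rewrite (limE _ (circle_mean G (cabs p / 2)) ca ltac:(lra)); last first.
  move=> d d0; exists (Num.max (cabs p / 2) (cabs p - d / 2)).
  have [h|h] := leP (cabs p / 2) (cabs p - d / 2); split => //; try lra.
    by rewrite ler0_norm; lra.
    by apply: inner; lra.
    by rewrite ler0_norm; lra.
apply/esym/limE => //; first lra.
move=> d d0; exists (Num.min (cabs p / 2) (d / 2)).
have [h|h] := leP (cabs p / 2) (d / 2); split => //; try lra.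
- by rewrite ger0_norm; lra.
- by rewrite ger0_norm; lra.
- by apply: inner; lra.
Qed.

Lemma kcont_id_cst (c : C) z : kcont (fun w : C => c * w) z.
Proof. by apply: kcontM; [exact: kcont_cst|exact: kcont_id]. Qed.

Lemma kderivZ_id (c : C) z : kderiv (fun w : C => c * w) z c.
Proof.
have := kderivM (kderiv_cst c z) (kderiv_id z).
by rewrite mul0r add0r mulr1.
Qed.

Lemma cabs_conjM (z : C) t : cabs (1 - conjc z * expi t) = cabs (expi t - z).
Proof.
rewrite -[RHS]cabsJ conjB expiJ -[RHS]mul1r -(cabs_expi t) -cabsM.
by rewrite mulrBr mulfV ?expi_neq0// (mulrC (expi t)).
Qed.

Lemma expi_sub_neq0 (z : C) t : cabs z < 1 -> expi t - z != 0.
Proof.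
by move=> z1; rewrite subr_eq0; apply: contraTneq z1 => <-; rewrite cabs_expi ltxx.
Qed.

Lemma neq0_1B (u : C) : cabs u < 1 -> 1 - u != 0.
Proof. by rewrite subr_eq0; apply: contraTneq => <-; rewrite cabs1 ltxx. Qed.

Lemma Re_cayley (u : C) : cabs u < 1 ->
  complex.Re ((1 + u) / (1 - u)) = (1 - cabs u ^+ 2) / cabs (1 - u) ^+ 2.
Proof.
move=> u1; have : cabs (1 - u) ^+ 2 != 0.
  by rewrite expf_neq0// cabs_eq0 neq0_1B.
rewrite !sqr_cabs; case: u {u1} => a b /= h; field.
by rewrite -(sub0r b).
Qed.

(** The kernel as the real part of a function holomorphic in the integration variable, on which the
    mean value property can act. *)
Lemma poissonE (z : C) t : cabs z < 1 ->
  poisson z t = complex.Re ((1 + conjc z * expi t) / (1 - conjc z * expi t)).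
Proof.
move=> z1; rewrite Re_cayley; last by rewrite cabsM cabsJ cabs_expi mulr1.
by rewrite cabs_conjM cabsM cabsJ cabs_expi mulr1.
Qed.

Lemma kcont_poisson_den (c z : C) : kcont (fun w : C => 1 - c * w) z.
Proof.
apply: kcontD; first exact: kcont_cst.
by apply: kcontN; exact: kcont_id_cst.
Qed.

Lemma kderiv_poisson_den (c z : C) : kderiv (fun w : C => 1 - c * w) z (- c).
Proof.
have := kderivD (kderiv_cst (1 : C) z) (kderivZ_id (- c) z).
by rewrite add0r; under eq_fun do rewrite mulNr; exact.
Qed.

Lemma cont_on_poisson (z : C) (a b : R) : cabs z < 1 -> cont_on (poisson z) a b.
Proof.
move=> z1.
rewrite (_ : poisson z = fun t => complex.Re
  ((1 + conjc z * pol 1 t) / (1 - conjc z * pol 1 t))); last first.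
  by apply/funext => t; rewrite pol1 poissonE.
apply: (@ccont_pol_cont_on _ (fun w => (1 + conjc z * w) / (1 - conjc z * w))) => t.
apply/ccontE; apply: kcontM.
  by apply: kcontD; [exact: kcont_cst|exact: kcont_id_cst].
apply: kcontV; last exact: kcont_poisson_den.
by rewrite neq0_1B// cabsM cabsJ cabs_pol// mulr1.
Qed.

Lemma outer_kernelE (z : C) t : cabs z < 1 ->
  complex.Re ((expi t + z) / (expi t - z)) = poisson z t.
Proof.
move=> z1; have e0 := expi_neq0 t.
have -> : (expi t + z) / (expi t - z) = (1 + z / expi t) / (1 - z / expi t).
  by field; rewrite e0 expi_sub_neq0.
rewrite Re_cayley; last by rewrite cabsM cabsV cabs_expi invr1 mulr1.
have -> : cabs (1 - z / expi t) = cabs (expi t - z).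
  have -> : 1 - z / expi t = (expi t - z) / expi t by field.
  by rewrite cabsM cabsV cabs_expi invr1 mulr1.
by rewrite cabsM cabsV cabs_expi invr1 mulr1.
Qed.

Lemma poisson_mass (z : C) : cabs z < 1 -> sint (poisson z) 0 (2 * pi) = 2 * pi.
Proof.
move=> z1; pose H (w : C) := (1 + conjc z * w) / (1 - conjc z * w).
(* [H] is holomorphic in the disk of radius [b^-1 > 1]; the 1/2 covers [z = 0]. *)
pose b := Num.max (cabs z) (1 / 2).
have b0 : 0 < b by rewrite lt_max; apply/orP; right; lra.
have b1 : b < 1 by rewrite gt_max z1; lra.
have zw w : cabs w < b^-1 -> cabs (conjc z * w) < 1.
  move=> wb; rewrite cabsM cabsJ; apply: (@le_lt_trans _ _ (b * cabs w)).
    by rewrite ler_wpM2r ?cabs_ge0// le_max lexx.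
  by rewrite mulrC -ltr_pdivlMr// div1r.
have dH w : cabs w < b^-1 -> exists d, has_cderiv H w d.
  move=> /zw/neq0_1B h; eexists; apply/has_cderivE; apply: kderivM.
    by apply: kderivD; [exact: kderiv_cst|exact: kderivZ_id].
  by apply: kderivV => //; exact: kderiv_poisson_den.
have := @mean_value H b^-1 0.
rewrite invf_gt1// cabs0 => /(_ b1 ltr01) mv.
transitivity (circle_mean H 1); last first.
  rewrite mv// => [|w /dH[d /has_cderiv_ccont]//|w /dH//].
  by rewrite /H mulr0 addr0 subr0 divr1 mul1r.
by rewrite /circle_mean; apply: eq_sint => t _; rewrite poissonE// pol1.
Qed.

(** Let g(w) = f(r w), holomorphic beyond the closed disk, let q be its difference quotient at [z],
    and K(w) = w (1 - |z|^2) / (1 - conj(z) w). On the unit circle q K equals g - g(z) times the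
    Poisson kernel, and K(0) = 0, so the mean value property of q K gives the formula. *)
Theorem poisson_formula f (r : R) (z : C) : holomorphic_disk f ->
  0 <= r < 1 -> cabs z < 1 ->
  sint (fun t => complex.Re (f (pol r t)) * poisson z t) 0 (2 * pi) =
  complex.Re (f (r%:C%C * z)) * (2 * pi).
Proof.
move=> dF /andP[r0 r1] z1.
pose b := Num.max (Num.max (cabs z) r) (1 / 2).
have b0 : 0 < b by rewrite lt_max; apply/orP; right; lra.
have b1 : b < 1 by rewrite !gt_max z1 r1; lra.
have bz : cabs z <= b by rewrite !le_max lexx.
have br : r <= b by rewrite !le_max lexx orbT.
have small c w : 0 <= c <= b -> cabs w < b^-1 -> c * cabs w < 1.
  move=> /andP[c0 cb] wb; apply: (@le_lt_trans _ _ (b * cabs w)).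
    by rewrite ler_wpM2r ?cabs_ge0.
  by rewrite mulrC -ltr_pdivlMr// div1r.
have zw w : cabs w < b^-1 -> 1 - conjc z * w != 0.
  by move=> wb; rewrite neq0_1B// cabsM cabsJ small// cabs_ge0.
have rw w : cabs w < b^-1 -> in_disk (r%:C%C * w).
  by move=> wb; rewrite /in_disk cabsM cabsR ger0_norm// small// r0.
pose g w := f (r%:C%C * w).
have dg w : cabs w < b^-1 -> exists d, kderiv g w d.
  move=> /rw/dF[d /has_cderivE hd]; exists (d * r%:C%C).
  exact: kderiv_comp (kderivZ_id _ _) hd.
have b'1 : 1 < b^-1 by rewrite invf_gt1.
have zb : cabs z < b^-1 by lra.
(* The factor [q] is continuous at [z], which therefore can be the exceptional point of
   [mean_value]. *)
have [dz [q [cq qz gq]]] := dg _ zb.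
pose K (w : C) := w * (1 - cabs z ^+ 2)%:C%C / (1 - conjc z * w).
have dK w : cabs w < b^-1 -> exists d, kderiv K w d.
  move=> /zw h; eexists; apply: kderivM.
    by apply: kderivM; [exact: kderiv_id|exact: kderiv_cst].
  by apply: kderivV => //; exact: kderiv_poisson_den.
have dq w : cabs w < b^-1 -> w != z -> exists d, kderiv q w d.
  move=> wb wz; have wz0 : 0 < `|w - z| by rewrite normr_gt0 subr_eq0.
  have dquot : exists d, kderiv (fun u => (g u - g z) / (u - z)) w d.
    have [d hd] := dg w wb; eexists; apply: kderivM.
      by apply: kderivD; [exact: hd|exact: kderiv_cst].
    apply: kderivV; first by rewrite subr_eq0.
    by apply: kderivD; [exact: kderiv_id|exact: kderiv_cst].
  have [d hd] := dquot; exists d; apply: kderiv_near wz0 _ hd => u uw.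
  rewrite gq mulfK// subr_eq0; apply: contraTneq uw => ->.
  by rewrite distrC ltxx.
have dG w : cabs w < b^-1 -> w != z -> exists d, has_cderiv (fun u => q u * K u) w d.
  move=> wb wz; have [d1 h1] := dq w wb wz; have [d2 h2] := dK w wb.
  by exists (d1 * K w + q w * d2); apply/has_cderivE; apply: (kderivM h1 h2).
have cG w : cabs w < b^-1 -> ccont (fun u => q u * K u) w.
  move=> wb; have [wz|wz] := eqVneq w z; last first.
    by have [d /has_cderiv_ccont] := dG w wb wz.
  apply/ccontE; rewrite wz; apply: kcontM => //.
  by have [d /kderiv_cont] := dK z zb.
have := mean_value b'1 z1 cG dG.
rewrite {2}/K !mul0r mulr0 mul0r.
have KE t : q (expi t) * K (expi t) = (g (expi t) - g z) * (poisson z t)%:C%C.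
  have e0 := expi_neq0 t; have ez := expi_sub_neq0 t z1.
  have zc : 1 - conjc z * expi t != 0 by apply: zw; rewrite cabs_expi.
  have -> : (poisson z t)%:C%C =
      expi t * (1 - cabs z ^+ 2)%:C%C / ((expi t - z) * (1 - conjc z * expi t)).
    rewrite /poisson rmorphM/= fmorphV/= -mulJc conjB expiJ; field.
    by rewrite e0 ez zc.
  by rewrite gq /K; field; rewrite ez zc.
move=> mv.
have cpol : cont_on (fun t => complex.Re (f (pol r t))) 0 (2 * pi).
  apply: ccont_pol_cont_on => t.
  have [|d /has_cderiv_ccont//] := dF (pol r t).
  by rewrite /in_disk cabs_pol.
have cpois := @cont_on_poisson z 0 (2 * pi) z1.
have -> : complex.Re (f (r%:C%C * z)) * (2 * pi) =
    sint (fun t => complex.Re (f (r%:C%C * z)) * poisson z t) 0 (2 * pi).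
  by rewrite sintZ// poisson_mass.
apply: subr0_eq; rewrite -sintB.
- rewrite -[RHS]mv /circle_mean; apply: eq_sint => t _; rewrite pol1 KE [in RHS]mulrC ReZ ReB.
  by rewrite /g /pol; ring.
- exact: cont_onM.
- by apply: cont_onM => //; exact: cont_on_cst.
Qed.

End mean_value_property.

(** * Schwarz-Pick *)

Section schwarz.
Variable R : realType.
Local Notation C := R[i].
Implicit Types (f g phi : C -> C) (u v w z : C).

Lemma poisson_ge0 z t : cabs z < 1 -> 0 <= poisson z t.
Proof.
by move=> z1; rewrite divr_ge0 ?sqr_ge0// subr_ge0 exprn_ile1// ?cabs_ge0 ?ltW.
Qed.

Lemma holo_ccont f w : holomorphic_disk f -> in_disk w -> ccont f w.
Proof. by move=> hf /hf[d /has_cderiv_ccont]. Qed.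

Lemma cont_on_circle f (r a b : R) : holomorphic_disk f -> 0 <= r < 1 ->
  cont_on (fun t => complex.Re (f (pol r t))) a b.
Proof.
move=> hf /andP[r0 r1]; apply: ccont_pol_cont_on => t; apply: holo_ccont => //.
by rewrite /in_disk cabs_pol.
Qed.

Lemma poisson0 t : poisson (0 : C) t = 1.
Proof. by rewrite /poisson subr0 cabs0 cabs_expi expr0n subr0 expr1n divr1. Qed.

(** A Schwarz lemma without the maximum principle. On the circle of radius [r], the product of g and
    the Poisson kernel at [w] is g w / e^(it) times that kernel plus (1 - |w|^2) h, where h(u) =
    g(u) / (1 - conj(w) u / r). The term with h integrates to zero because h(0) = 0, and the other
    is at most |w| times the kernel. *)
Lemma schwarz_lemma_circle g (r : R) w : holomorphic_disk g ->
  (forall u, in_disk u -> cabs (g u) <= 1) -> g 0 = 0 -> 0 <= r < 1 ->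
  cabs w < r -> complex.Re (g (r%:C%C * w)) <= cabs w.
Proof.
move=> hg g1 g0 /[dup] r01 /andP[r0 r1] wr; have w1 : cabs w < 1 by lra.
have rgt0 : 0 < r by have := cabs_ge0 w; lra.
have rC0 : r%:C%C != 0 :> C by rewrite -cabs_eq0 cabsR normr_eq0 gt_eqF.
pose h u := g u / (1 - (conjc w / r%:C%C) * u).
have wr1 : cabs (conjc w / r%:C%C) < 1.
  by rewrite cabsM cabsV cabsJ cabsR ger0_norm// ltr_pdivrMr// mul1r.
have hh : holomorphic_disk h.
  move=> u u1; have [d /has_cderivE hd] := hg u u1; eexists; apply/has_cderivE.
  apply: kderivM hd _; apply: kderivV; last exact: kderiv_poisson_den.
  rewrite neq0_1B// cabsM; move: u1; rewrite /in_disk.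
  by have := cabs_ge0 u; have := cabs_ge0 (conjc w / r%:C%C); nra.
have := poisson_formula hg r01 w1.
have o0 : cabs (0 : C) < 1 by rewrite cabs0.
have := poisson_formula hh r01 o0; rewrite mulr0 /h g0 mul0r mul0r => P0 Pw.
rewrite -(@ler_pM2r _ (2 * pi)) ?mulr_gt0 ?pi_gt0// -Pw.
have -> : cabs w * (2 * pi) =
    sint (fun t => cabs w * poisson w t) 0 (2 * pi) + (1 - cabs w ^+ 2) *
    sint (fun t => complex.Re (h (pol r t)) * poisson 0 t) 0 (2 * pi).
  by rewrite P0 mulr0 addr0 sintZ ?poisson_mass//; exact: cont_on_poisson.
have ch : cont_on (fun t => complex.Re (h (pol r t)) * poisson 0 t) 0 (2 * pi).
  by apply: cont_onM; [exact: cont_on_circle|exact: cont_on_poisson].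
have cw : cont_on (fun t => cabs w * poisson w t) 0 (2 * pi).
  by apply: cont_onM; [exact: cont_on_cst|exact: cont_on_poisson].
rewrite -sintZ// -sintD//; last first.
  by apply: cont_onM => //; exact: cont_on_cst.
apply: le_sint => [||t _].
- by apply: cont_onM; [exact: cont_on_circle|exact: cont_on_poisson].
- by apply: cont_onD => //; apply: cont_onM => //; exact: cont_on_cst.
rewrite poisson0 mulr1 -ReZ.
have e0 := expi_neq0 t; have ez := expi_sub_neq0 t w1.
have zc : 1 - conjc w * expi t != 0.
  by rewrite neq0_1B// cabsM cabsJ cabs_expi mulr1.
have -> : complex.Re (g (pol r t)) * poisson w t =
    complex.Re (g (pol r t) * (w / expi t)) * poisson w t +
    complex.Re ((1 - cabs w ^+ 2)%:C%C * h (pol r t)).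
  rewrite -mulrC -ReZ -[in RHS]mulrC -ReZ -ReD; congr complex.Re.
  rewrite /h /pol.
  have -> : conjc w / r%:C%C * (r%:C%C * expi t) = conjc w * expi t by field.
  have -> : (poisson w t)%:C%C =
      expi t * (1 - cabs w ^+ 2)%:C%C / ((expi t - w) * (1 - conjc w * expi t)).
    rewrite /poisson rmorphM/= fmorphV/= -mulJc conjB expiJ; field.
    by rewrite e0 ez zc.
  by field; rewrite e0 ez zc.
rewrite lerD2r ler_wpM2r ?poisson_ge0//; apply: le_trans (Re_le _) _.
rewrite !cabsM cabsV cabs_expi invr1 mulr1 ler_piMl ?cabs_ge0//.
by apply: g1; rewrite /in_disk cabs_pol.
Qed.

Lemma schwarz_lemma g w : holomorphic_disk g ->
  (forall u, in_disk u -> cabs (g u) <= 1) -> g 0 = 0 -> in_disk w ->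
  cabs (g w) <= cabs w.
Proof.
move=> hg g1 g0 w1; rewrite leNgt; apply/negP => wg.
have gw1 := g1 w w1; have cw := cabs_ge0 w.
have gw0 : 0 < cabs (g w) by lra.
pose x := cabs w / cabs (g w).
have xg : x * cabs (g w) = cabs w by rewrite divfK// gt_eqF.
have x0 : 0 <= x by rewrite divr_ge0// cabs_ge0.
have x1 : x < 1 by rewrite ltr_pdivrMr// mul1r.
(* Since |w| <= x < r^2, the point w / r is admissible on the circle of radius [r]. For the rotation
   of g that makes its value at [w] positive, the circle estimate gives |g(w)| r <= |w|, that is r
   <= x, against r > x. *)
pose r := (1 + x) / 2; have r01 : 0 <= r < 1 by rewrite /r; apply/andP; split; lra.
have r0 : 0 < r by rewrite /r; lra.
pose c : C := (cabs (g w))%:C%C / g w.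
have gwn0 : g w != 0 by rewrite -cabs_gt0.
have c1 : cabs c = 1.
  by rewrite cabsM cabsV cabsR ger0_norm ?cabs_ge0// mulfV// gt_eqF.
have := @schwarz_lemma_circle (fun u => c * g u) r (w / r%:C%C).
rewrite cabsM cabsV cabsR (ger0_norm (ltW r0)).
have -> : r%:C%C * (w / r%:C%C) = w :> C.
  by field; rewrite -cabs_eq0 cabsR normr_eq0 gt_eqF.
rewrite /c divfK// g0 mulr0 -/c => /(_ _ _ erefl r01).
have -> : cabs w / r < r by rewrite ltr_pdivrMr// /r; nra.
rewrite /= ler_pdivlMr// => H.
have : cabs (g w) * r <= cabs w.
  apply: H => // u u1.
    have [d /has_cderivE hd] := hg u u1; eexists; apply/has_cderivE.
    exact: kderivM (kderiv_cst _ _) hd.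
  by rewrite cabsM c1 mul1r g1.
by rewrite /r; nra.
Qed.

Lemma mobius_identity (a u : C) :
  cabs (1 - conjc a * u) ^+ 2 - cabs (u - a) ^+ 2 =
  (1 - cabs a ^+ 2) * (1 - cabs u ^+ 2).
Proof. by rewrite !sqr_cabs; case: a => ? ?; case: u => ? ? /=; ring. Qed.

(** The Schwarz lemma for psi o phi o tau, where the disk automorphisms tau and psi send 0 to [z]
    and [phi z] to 0, squared and rewritten through [mobius_identity]. In this form it bounds the
    squared modulus of the kernel k at [w]. *)
Theorem schwarz_pick phi z w : holomorphic_disk phi ->
  (forall u, in_disk u -> cabs (phi u) <= 1) -> cabs (phi z) < 1 ->
  in_disk z -> in_disk w ->
  (1 - cabs z ^+ 2) * (1 - cabs w ^+ 2) * cabs (1 - conjc (phi z) * phi w) ^+ 2 <=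
  (1 - cabs (phi z) ^+ 2) * (1 - cabs (phi w) ^+ 2) * cabs (1 - conjc z * w) ^+ 2.
Proof.
move=> hphi phi1 a1; rewrite /in_disk => z1 w1; set a := phi z in a1 *.
have lt1 u v : cabs u < 1 -> cabs v <= 1 -> cabs (conjc u * v) < 1.
  by move=> u1 v1; rewrite cabsM cabsJ; have := cabs_ge0 u; have := cabs_ge0 v; nra.
(* The double negation lets [kderiv_poisson_den] and [mobius_identity] at [- z] apply. *)
pose tau u := (u + z) / (1 - (- conjc z) * u).
pose psi v := (v - a) / (1 - conjc a * v).
have tn0 u : cabs u < 1 -> 1 - (- conjc z) * u != 0.
  by move=> u1; rewrite neq0_1B// mulNr cabsN lt1// ltW.
have pn0 v : cabs v <= 1 -> 1 - conjc a * v != 0.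
  by move=> v1; rewrite neq0_1B// lt1.
have sq1 (c : R) : 0 <= c -> c < 1 -> 0 < 1 - c ^+ 2 by move=> ? ?; nra.
have tau1 u : cabs u < 1 -> cabs (tau u) < 1.
  move=> u1; have := mobius_identity (- z) u.
  rewrite cabsN rmorphN/= opprK /tau cabsM cabsV => id1.
  have t0 : 0 < cabs (1 - - conjc z * u) by rewrite cabs_gt0 tn0.
  rewrite ltr_pdivrMr// mul1r -(@ltr_pXn2r _ 2)// ?nnegrE ?cabs_ge0//.
  by rewrite -subr_gt0 id1 mulr_gt0// sq1// cabs_ge0.
have psi1 v : cabs v <= 1 -> cabs (psi v) <= 1.
  move=> v1; have id1 := mobius_identity a v.
  rewrite /psi cabsM cabsV.
  have t0 : 0 < cabs (1 - conjc a * v) by rewrite cabs_gt0 pn0.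
  rewrite ler_pdivrMr// mul1r -(@ler_pXn2r _ 2)// ?nnegrE ?cabs_ge0//.
  rewrite -subr_ge0 id1 mulr_ge0//; first by rewrite ltW// sq1// cabs_ge0.
  by rewrite subr_ge0 exprn_ile1// cabs_ge0.
have hg : holomorphic_disk (fun u => psi (phi (tau u))).
  move=> u u1; have [d /has_cderivE hd] := hphi _ (tau1 u u1).
  have d1 : exists d, kderiv tau u d.
    eexists; apply: kderivM.
      by apply: kderivD; [exact: kderiv_id|exact: kderiv_cst].
    by apply: kderivV; [exact: tn0|exact: kderiv_poisson_den].
  have [e he] := d1.
  have d2 : exists d, kderiv psi (phi (tau u)) d.
    eexists; apply: kderivM.
      by apply: kderivD; [exact: kderiv_id|exact: kderiv_cst].
    by apply: kderivV; [exact/pn0/phi1/tau1|exact: kderiv_poisson_den].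
  have [e' he'] := d2; exists (e' * (d * e)); apply/has_cderivE.
  exact: (kderiv_comp (kderiv_comp he hd) he').
pose u := (w - z) / (1 - conjc z * w).
have zwn0 : 1 - conjc z * w != 0 by rewrite neq0_1B// lt1// ltW.
have t0 : 0 < cabs (1 - conjc z * w) by rewrite cabs_gt0.
have u1 : cabs u < 1.
  rewrite /u cabsM cabsV ltr_pdivrMr// mul1r -(@ltr_pXn2r _ 2)// ?nnegrE ?cabs_ge0//.
  by rewrite -subr_gt0 mobius_identity mulr_gt0// sq1// cabs_ge0.
have zzn0 : 1 - conjc z * z != 0 by rewrite neq0_1B// lt1// ltW.
have tauu : tau u = w.
  rewrite /tau /u; field; apply/andP; split=> //.
  have -> : 1 - conjc z * w - - conjc z * (w - z) = 1 - conjc z * z by ring.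
  done.
have := schwarz_lemma hg _ _ u1; rewrite tauu => H.
have {H} : cabs (psi (phi w)) <= cabs u.
  apply: H => [v v1|]; first exact/psi1/phi1/tau1.
  by rewrite /tau add0r mulr0 subr0 divr1 /psi subrr mul0r.
have t1 : 0 < cabs (1 - conjc a * phi w) by rewrite cabs_gt0 pn0// phi1.
rewrite /psi /u !cabsM !cabsV ler_pdivrMr// mulrAC ler_pdivlMr// => H.
have {H} : (cabs (phi w - a) * cabs (1 - conjc z * w)) ^+ 2 <=
    (cabs (w - z) * cabs (1 - conjc a * phi w)) ^+ 2.
  by rewrite ler_pXn2r// nnegrE mulr_ge0// cabs_ge0.
have := mobius_identity a (phi w); have := mobius_identity z w.
rewrite !exprMn => <- <-; lra.
Qed.

End schwarz.

(** * The Poisson formula for log |1 - u| *)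

Section poisson_log.
Variable R : realType.
Local Notation C := R[i].

(** Write |1 - x|^2 = 1 + t and squeeze t / (1 + t) <= ln (1 + t) <= t. As 1 + t >= 1/4 and t^2 <=
    25/4 |x|^2, the lower bound loses at most 25 |x|^2 before halving; 13 is a rounded constant. *)
Lemma ln_cabs_1B (x : C) : cabs x <= 1 / 2 ->
  `|ln (cabs (1 - x)) + complex.Re x| <= 13 * cabs x ^+ 2.
Proof.
move=> x2; have c0 := cabs_ge0 x.
have n0 : 0 < cabs (1 - x).
  by have := cabs_sub_ge 1 x; rewrite cabs1; lra.
have Rx := Re_le_cabs x.
pose t := - (2 * complex.Re x) + cabs x ^+ 2.
have tE : cabs (1 - x) ^+ 2 = 1 + t.
  by rewrite /t !sqr_cabs; case: (x) => a b /=; ring.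
have lnE : ln (cabs (1 - x)) = ln (1 + t) / 2.
  by rewrite -tE lnXn// mulr2n; lra.
have t14 : 1 / 4 <= 1 + t.
  by rewrite -tE; have := cabs_sub_ge 1 x; rewrite cabs1; nra.
have t0 : 0 < 1 + t by lra.
have up : ln (1 + t) <= t by apply: le_ln1Dx; lra.
have low : t / (1 + t) <= ln (1 + t).
  (* The lower bound is the upper bound read at the inverse of 1 + t. *)
  have := @le_ln1Dx R (- t / (1 + t)).
  have -> : 1 + - t / (1 + t) = (1 + t)^-1 by field; lra.
  rewrite lnV ?posrE// mulNr => H.
  suff : -1 < - (t / (1 + t)) by move=> /H; lra.
  have -> : - (t / (1 + t)) = (1 + t)^-1 - 1 by field; lra.
  by have : 0 < (1 + t)^-1 by [rewrite invr_gt0]; lra.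
have tsq : t ^+ 2 <= 25 / 4 * cabs x ^+ 2.
  have : `|t| <= 5 / 2 * cabs x.
    by move: Rx; rewrite /t !ler_norml => /andP[? ?]; apply/andP; split; nra.
  by rewrite ler_norml => /andP[? ?]; nra.
have low' : t - 25 * cabs x ^+ 2 <= t / (1 + t).
  have : 0 <= cabs x ^+ 2 * (1 + t - 1 / 4) by rewrite mulr_ge0 ?sqr_ge0//; lra.
  by rewrite ler_pdivlMr//; nra.
have tv : t = - (2 * complex.Re x) + cabs x ^+ 2 by [].
by clearbody t; rewrite lnE ler_norml; apply/andP; split; lra.
Qed.

(** Cutting [0, 1] into N equal steps bounds the total increment by K / N, for every large N. *)
Lemma quadratic_increments_cst (g : R -> R) (d K : R) : 0 < d ->
  (forall s s', 0 <= s <= 1 -> 0 <= s' <= 1 -> `|s' - s| <= d ->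
    `|g s' - g s| <= K * (s' - s) ^+ 2) -> g 1 = g 0.
Proof.
move=> d0 hg; apply/eqP; rewrite -subr_eq0 -normr_eq0; apply/negP => /negP nz.
set e : R := `|g 1 - g 0| in nz; have e0 : 0 < e by rewrite lt_neqAle eq_sym nz normr_ge0.
pose N := (Num.truncn (Num.max (K / e) d^-1)).+1.
have : Num.max (K / e) d^-1 < N%:R by exact: truncnS_gt.
rewrite gt_max => /andP[NK Nd].
have N0 : 0 < N%:R :> R by rewrite ltr0n.
have dN : N%:R^-1 <= d by rewrite -[d]invrK lef_pV2 ?posrE ?invr_gt0// ltW.
have step k : (k <= N)%N -> `|g (k%:R / N%:R) - g 0| <= K * N%:R^-1 ^+ 2 * k%:R.
  elim: k => [|k IH] kN; first by rewrite mul0r subrr normr0 mulr0.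
  have in01 j : (j <= N)%N -> 0 <= j%:R / (N%:R : R) <= 1.
    by move=> jN; rewrite divr_ge0//= ler_pdivrMr// mul1r ler_nat.
  have dE : k.+1%:R / N%:R - k%:R / N%:R = N%:R^-1 :> R.
    by rewrite -mulrBl -natrB// subSnn mul1r.
  have := hg _ _ (in01 k (ltnW kN)) (in01 _ kN).
  have Ni : 0 <= N%:R^-1 :> R by rewrite invr_ge0 ltW.
  rewrite dE (ger0_norm Ni) => /(_ dN) h.
  have -> : g (k.+1%:R / N%:R) - g 0 =
    (g (k.+1%:R / N%:R) - g (k%:R / N%:R)) + (g (k%:R / N%:R) - g 0) by ring.
  apply: le_trans (ler_normD _ _) _; have IHk := IH (ltnW kN).
  by rewrite -[k.+1%:R in leRHS]natr1; lra.
have := step N (leqnn N); rewrite divff ?gt_eqF// -/e.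
have -> : K * N%:R^-1 ^+ 2 * N%:R = K / N%:R by field; rewrite gt_eqF.
rewrite ler_pdivlMr// leNgt; move: NK; rewrite ltr_pdivrMr// mulrC.
by move=> ->.
Qed.

Lemma cont_on_comp (f g : R -> R) a b : cont_on f a b ->
  (forall x, a <= x <= b -> {for f x, continuous g}) ->
  cont_on (fun x => g (f x)) a b.
Proof. by move=> fab gf x xab; apply: continuous_comp; [exact: fab|exact: gf]. Qed.

Lemma cont_on_cabs (h : C -> C) (r a b : R) : 0 <= r < 1 -> holomorphic_disk h ->
  cont_on (fun t => cabs (h (pol r t))) a b.
Proof.
move=> /andP[r0 r1] hh t _; apply/cvgrPdist_lt => e e0.
have rt : in_disk (pol r t) by rewrite /in_disk cabs_pol.
have [d d0 hd] := ccont_pol (holo_ccont hh rt) e0.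
apply/nbhs_ballP; exists d => // u; rewrite /ball/= distrC => ut.
have := hd r u; rewrite subrr normr0 => /(_ d0 ut).
have := cabs_sub_ge (h (pol r u)) (h (pol r t)).
have := cabs_sub_ge (h (pol r t)) (h (pol r u)); rewrite cabsB => ? ? ?.
by rewrite ltr_norml; apply/andP; split; lra.
Qed.

Variables (u : C -> C) (q : R).
Hypotheses (hu : holomorphic_disk u) (q1 : q < 1).
Hypothesis uq : forall w, in_disk w -> cabs (u w) <= q.

Let su_le s w : 0 <= s <= 1 -> in_disk w -> cabs (s%:C%C * u w) <= q.
Proof.
move=> /andP[s0 s1] /uq uw; rewrite cabsM cabsR ger0_norm//.
by have := cabs_ge0 (u w); nra.
Qed.

Let ge_1su s w : 0 <= s <= 1 -> in_disk w -> 1 - q <= cabs (1 - s%:C%C * u w).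
Proof.
by move=> s01 /(su_le s01) h; have := cabs_sub_ge 1 (s%:C%C * u w); rewrite cabs1; lra.
Qed.

Let holo_1su s : holomorphic_disk (fun w => 1 - s%:C%C * u w).
Proof.
move=> w /hu[d /has_cderivE hd]; eexists; apply/has_cderivE.
exact: kderiv_comp hd (kderiv_poisson_den _ _).
Qed.

Lemma cont_on_ln_1B (s r a b : R) : 0 <= s <= 1 -> 0 <= r < 1 ->
  cont_on (fun t => ln (cabs (1 - s%:C%C * u (pol r t)))) a b.
Proof.
move=> s01 r01; apply: cont_on_comp.
  exact: cont_on_cabs r01 (holo_1su s).
move=> t _; apply: continuous_ln; move/andP: r01 => [r0 r1].
by apply: lt_le_trans (ge_1su s01 _); [rewrite subr_gt0|rewrite /in_disk cabs_pol].
Qed.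

Let combine (I1 I2 L1 L2 Y B p : R) : 0 <= p -> I2 - I1 + Y * p <= B * p ->
  - B * p <= I2 - I1 + Y * p -> `|L2 - L1 - - Y| <= B ->
  `|I2 - L2 * p - (I1 - L1 * p)| <= B * (2 * p).
Proof.
move=> p0 up low LB; have : `|(L2 - L1 - - Y) * p| <= B * p.
  by rewrite normrM (ger0_norm p0) ler_wpM2r.
by rewrite !ler_norml => /andP[? ?]; apply/andP; split; lra.
Qed.

(** A deformation replaces the complex logarithm. Let g(s) be the defect of the formula for s u;
    g(0) = 0. Since 1 - s' u = (1 - s u)(1 - eta y) with eta = s' - s and y = u / (1 - s u), the
    logarithm changes by - eta Re y up to O(eta^2). The linear part obeys [poisson_formula], so g
    has quadratic increments and is constant. *)
Theorem poisson_ln_1B r z : 0 <= r < 1 -> cabs z < 1 ->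
  sint (fun t => ln (cabs (1 - u (pol r t))) * poisson z t) 0 (2 * pi) =
  ln (cabs (1 - u (r%:C%C * z))) * (2 * pi).
Proof.
move=> r01 z1; have [r0 r1] := andP r01; have q1' := q1.
have pt t : in_disk (pol r t) by rewrite /in_disk cabs_pol.
have rz : in_disk (r%:C%C * z).
  by rewrite /in_disk cabsM cabsR ger0_norm//; have := cabs_ge0 z; nra.
have cP := @cont_on_poisson R z 0 (2 * pi) z1.
pose g s := sint (fun t => ln (cabs (1 - s%:C%C * u (pol r t))) * poisson z t)
  0 (2 * pi) - ln (cabs (1 - s%:C%C * u (r%:C%C * z))) * (2 * pi).
have g0 : g 0 = 0.
  rewrite /g mul0r subr0 cabs1 ln1 mul0r subr0.
  rewrite (@eq_sint _ _ (fun=> 0)); first by rewrite sint_cst ?twopi_ge0// mul0r.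
  by move=> t _; rewrite mul0r subr0 cabs1 ln1 mul0r.
suff : g 1 = g 0.
  rewrite g0 /g rmorph1 mul1r => /subr0_eq <-.
  by apply: eq_sint => t _; rewrite mul1r.
(* 52 pi is the 13 of [ln_cabs_1B], doubled because the error occurs in the integral and in the
   point value, times the mass 2 pi. As |y| <= 1 / (1 - q), steps of at most (1 - q) / 2 keep |eta
   y| <= 1/2. *)
apply: (@quadratic_increments_cst g ((1 - q) / 2) (52 * pi / (1 - q) ^+ 2)).
  by rewrite divr_gt0// subr_gt0.
move=> s s' s01 s01' ss.
pose y w := u w / (1 - s%:C%C * u w).
have n0 s0 w : 0 <= s0 <= 1 -> in_disk w -> 1 - s0%:C%C * u w != 0.
  by move=> h w1; rewrite -cabs_gt0; apply: lt_le_trans (ge_1su h w1); rewrite subr_gt0.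
have hy : holomorphic_disk y.
  move=> w w1; have [d /has_cderivE hd] := hu w1.
  have [d' /has_cderivE hd'] := holo_1su s w1.
  eexists; apply/has_cderivE; apply: kderivM hd _.
  by apply: kderivV hd'; exact: n0.
have yb w : in_disk w -> cabs (y w) <= (1 - q)^-1.
  move=> w1; rewrite /y cabsM cabsV.
  have h := ge_1su s01 w1; have qq : 0 < 1 - q by lra.
  have uw : cabs (u w) <= 1 by have := uq w1; lra.
  apply: (@le_trans _ _ (1 * (cabs (1 - s%:C%C * u w))^-1)).
    by rewrite ler_wpM2r ?invr_ge0 ?cabs_ge0.
  have cp : 0 < cabs (1 - s%:C%C * u w) by lra.
  by rewrite mul1r lef_pV2 ?posrE.
pose eta := s' - s.
have key w : in_disk w -> `|ln (cabs (1 - s'%:C%C * u w)) -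
    ln (cabs (1 - s%:C%C * u w)) - - eta * complex.Re (y w)| <=
    13 * (eta ^+ 2 / (1 - q) ^+ 2).
  move=> w1; have h := n0 _ _ s01 w1; have h' := n0 _ _ s01' w1.
  have fE : 1 - s'%:C%C * u w = (1 - s%:C%C * u w) * (1 - eta%:C%C * y w).
    by rewrite /y /eta rmorphB; field.
  have ey : 1 - eta%:C%C * y w != 0.
    by apply: contraNneq h'; rewrite fE => ->; rewrite mulr0.
  rewrite fE cabsM lnM ?posrE ?cabs_gt0//.
  rewrite (_ : _ - _ - _ = ln (cabs (1 - eta%:C%C * y w)) +
    complex.Re (eta%:C%C * y w)); last by rewrite ReZ; ring.
  have eyb : cabs (eta%:C%C * y w) <= `|eta| / (1 - q).
    by rewrite cabsM cabsR ler_wpM2l// yb.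
  apply: le_trans (ln_cabs_1B _) _.
    apply: le_trans eyb _; rewrite ler_pdivrMr; last lra.
    by rewrite mulrC mulrA mulr1; lra.
  rewrite ler_pM2l// -(real_normK (num_real eta)) -expr_div_n.
  by rewrite ler_pXn2r// ?nnegrE ?cabs_ge0// divr_ge0//; lra.
have Py := poisson_formula hy r01 z1.
have c1 := @cont_on_ln_1B s r 0 (2 * pi) s01 r01.
have c2 := @cont_on_ln_1B s' r 0 (2 * pi) s01' r01.
have cy := cont_on_circle (a := 0) (b := 2 * pi) hy r01.
set B := 13 * _ in key.
have cT : cont_on (fun t => ((ln (cabs (1 - s'%:C%C * u (pol r t))) -
    ln (cabs (1 - s%:C%C * u (pol r t)))) - - eta * complex.Re (y (pol r t))) *
    poisson z t) 0 (2 * pi).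
  apply: cont_onM => //; apply: cont_onB; first exact: cont_onB.
  by apply: cont_onM => //; exact: cont_on_cst.
have cB b : cont_on (fun t => b * poisson z t) 0 (2 * pi).
  by apply: cont_onM => //; exact: cont_on_cst.
have sintT : sint (fun t => ((ln (cabs (1 - s'%:C%C * u (pol r t))) -
    ln (cabs (1 - s%:C%C * u (pol r t)))) - - eta * complex.Re (y (pol r t))) *
    poisson z t) 0 (2 * pi) =
    sint (fun t => ln (cabs (1 - s'%:C%C * u (pol r t))) * poisson z t) 0 (2 * pi) -
    sint (fun t => ln (cabs (1 - s%:C%C * u (pol r t))) * poisson z t) 0 (2 * pi) +
    eta * (complex.Re (y (r%:C%C * z)) * (2 * pi)).
  rewrite -Py -sintZ; last exact: cont_onM.
  rewrite -sintB; [|exact: cont_onM|exact: cont_onM].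
  rewrite -sintD; last 2 first.
  - by apply: cont_onB; exact: cont_onM.
  - by apply: cont_onM; [exact: cont_on_cst|exact: cont_onM].
  by apply: eq_sint => t _; ring.
have up : sint (fun t => ((ln (cabs (1 - s'%:C%C * u (pol r t))) -
    ln (cabs (1 - s%:C%C * u (pol r t)))) - - eta * complex.Re (y (pol r t))) *
    poisson z t) 0 (2 * pi) <= B * (2 * pi).
  rewrite -{2}(poisson_mass z1) -sintZ//; apply: le_sint => // t _.
  rewrite ler_wpM2r ?poisson_ge0//; exact: le_trans (ler_norm _) (key _ (pt t)).
have low : - B * (2 * pi) <= sint (fun t => ((ln (cabs (1 - s'%:C%C * u (pol r t))) -
    ln (cabs (1 - s%:C%C * u (pol r t)))) - - eta * complex.Re (y (pol r t))) *
    poisson z t) 0 (2 * pi).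
  rewrite -{1}(poisson_mass z1) -sintZ//; apply: le_sint => // t _.
  rewrite ler_wpM2r ?poisson_ge0//.
  by have := key _ (pt t); rewrite ler_norml => /andP[].
have kz := key _ rz; move: up low; rewrite sintT mulrA => up low.
have -> : 52 * pi / (1 - q) ^+ 2 * (s' - s) ^+ 2 = B * (2 * (2 * pi)).
  by rewrite /B -/eta; ring.
rewrite /g; apply: (combine (@twopi_ge0 R) up low).
by move: kz; rewrite mulNr.
Qed.

End poisson_log.

(** * The completed Lebesgue measure *)

Section completed_lebesgue.
Variable R : realType.
Local Notation mu := (@lebesgue_measure R).

Lemma lmeasurable_borel (A : set R) : measurable (A : set (measurableTypeR R)) ->
  lmeasurable A.
Proof. exact: sub_caratheodory. Qed.

(** The identity as a map from the completed sigma-algebra to the Borel one. It pushes the completed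
    measure to Lebesgue measure, which transports integrals of continuous functions. *)
Definition leb_id (t : lebT R) : measurableTypeR R := t.

Lemma measurable_leb_id : measurable_fun [set: lebT R] leb_id.
Proof. by move=> _ Y mY; rewrite setTI; exact: lmeasurable_borel. Qed.

Let pushE A : measurable A -> pushforward (@leb R) leb_id A = mu A.
Proof. by []. Qed.

Lemma leb_integrable (f : R -> R) (D : set R) : continuous f ->
  measurable (D : set (measurableTypeR R)) -> mu.-integrable D (EFin \o f) ->
  (@leb R).-integrable (D : set (lebT R)) (EFin \o f).
Proof.
move=> cf mD /integrableP[mf fi]; have mfT := continuous_measurable_fun cf.
apply/integrableP; split.
  apply/measurable_EFinP; apply: (@measurableT_comp _ _ _ _ _ _ f _ leb_id) => //.
  exact: measurable_funTS measurable_leb_id.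
have := @ge0_integral_pushforward _ _ _ _ R leb_id measurable_leb_id (@leb R)
  D (fun t => `|(f t)%:E|%E).
rewrite preimage_id => <-//.
by apply: measurableT_comp => //; apply/measurable_EFinP; exact: measurable_funTS.
Qed.

Lemma Rintegral_leb (f : R -> R) (D : set R) : continuous f ->
  measurable (D : set (measurableTypeR R)) -> mu.-integrable D (EFin \o f) ->
  Rintegral (@leb R) (D : set (lebT R)) f = Rintegral mu D f.
Proof.
move=> cf mD fi; congr fine.
have mf : measurable_fun [set: measurableTypeR R] (EFin \o f).
  by apply/measurable_EFinP; exact: continuous_measurable_fun.
have := @integral_pushforward _ _ _ _ R leb_id measurable_leb_id (@leb R) D _ mf.
by rewrite preimage_id => <-//; exact: leb_integrable.
Qed.

Definition circ : set R := `[0, 2 * pi[.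

Lemma measurable_circ : measurable (circ : set (measurableTypeR R)).
Proof. exact: measurable_itv. Qed.

Lemma lebesgue_circ_integrable (f : R -> R) : continuous f ->
  mu.-integrable circ (EFin \o f).
Proof.
move=> cf; have : cont_on f 0 (2 * pi) by move=> x _; exact: cf.
move/cont_on_integrable; apply: integrableS => //.
  exact: measurable_circ.
by rewrite /circ; apply: subset_itvl; rewrite bnd_simp.
Qed.

Lemma circ_integrable (f : R -> R) : continuous f ->
  (@leb R).-integrable (circ : set (lebT R)) (EFin \o f).
Proof.
move=> cf; apply: leb_integrable => //; last exact: lebesgue_circ_integrable.
exact: measurable_circ.
Qed.

Lemma Rintegral_circ (f : R -> R) : continuous f ->
  Rintegral (@leb R) (circ : set (lebT R)) f = sint f 0 (2 * pi).
Proof.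
move=> cf; have fi := lebesgue_circ_integrable cf.
rewrite Rintegral_leb//; last exact: measurable_circ.
by rewrite /circ Rintegral_itv_bndo_bndc.
Qed.

End completed_lebesgue.

(** * A one-sided Julia-Caratheodory estimate along a radius *)

Section julia.
Variable R : realType.
Local Notation C := R[i].
Implicit Types (phi dphi : C -> C).

(** Multiplication by a unimodular constant makes the increment real and nonnegative, and the real
    mean value theorem applies to the real part. *)
Lemma radial_mvt phi dphi (t r s M : R) : derivative_on_disk phi dphi ->
  0 <= r -> r < s -> s < 1 ->
  (forall x, r <= x <= s -> cabs (dphi (pol x t)) <= M) ->
  cabs (phi (pol s t) - phi (pol r t)) <= M * (s - r).
Proof.
move=> dF r0 rs s1 dM; set v := phi (pol s t) - phi (pol r t).
have [->|v0] := eqVneq v 0.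
  rewrite cabs0 mulr_ge0 ?subr_ge0 ?(ltW rs)//; apply: le_trans (cabs_ge0 _) (dM r _).
  by rewrite lexx ltW.
pose c : C := (cabs v)%:C%C / v.
have c1 : cabs c = 1.
  by rewrite cabsM cabsV cabsR ger0_norm ?cabs_ge0// mulfV// cabs_eq0.
pose f x := complex.Re (c * phi (pol x t)).
have derf (x : R) : 0 <= x -> x < 1 ->
    is_derive x 1 f (complex.Re (c * (dphi (pol x t) * expi t))).
  move=> x0 x1.
  have px : in_disk (pol x t) by rewrite /in_disk cabs_pol.
  have polE y : pol y t = expi t * y%:C%C by rewrite /pol mulrC.
  have /has_cderivE := dF _ px; rewrite polE => hd.
  have := kderivM (kderiv_cst c x%:C%C) (kderiv_comp (kderivZ_id (expi t) x%:C%C) hd).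
  rewrite mul0r add0r => -[q [/ccontE cq qx hq]].
  apply/is_derive1_caratheodory; exists (fun y => complex.Re (q y%:C%C)); split.
  - move=> y; rewrite /f !polE -ReB hq -rmorphB.
    by rewrite [q _ * _]mulrC ReZ mulrC.
  - apply/cvgrPdist_lt => e /cq[d d0 hd']; apply/nbhs_ballP; exists d => // y.
    rewrite /ball/= distrC => yx; rewrite distrC -ReB.
    apply: le_lt_trans (Re_le_cabs _) _; apply: hd'.
    by rewrite -rmorphB cabsR.
  - by rewrite qx.
have [x|x|x xrs fE] := @MVT_segment R f
  (fun x => complex.Re (c * (dphi (pol x t) * expi t))) r s (ltW rs).
- by rewrite in_itv/= => /andP[? ?]; apply: derf; lra.
- apply: continuous_in_subspaceT => {}x; rewrite inE/= in_itv/= => /andP[? ?].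
  have dx : is_derive x 1 f (complex.Re (c * (dphi (pol x t) * expi t))).
    by apply: derf; lra.
  by apply: differentiable_continuous; apply/derivable1_diffP.
have -> : cabs v = f s - f r.
  by rewrite /f -ReB -mulrBr -/v /c divfK.
rewrite fE ler_wpM2r ?subr_ge0 ?(ltW rs)//; apply: le_trans (Re_le _) _.
by rewrite cabsM c1 mul1r cabsM cabs_expi mulr1 dM.
Qed.

(** Near the end of the radius |phi'| is at most M, slightly above |d|. [radial_mvt] from r to s,
    with s tending to 1, gives |a - phi(r e^(it))| <= M (1 - r) where |a| = 1. Hence 1 - |phi|^2 <=
    2 M (1 - r), and 2 is close to 1 + r. *)
Lemma julia phi dphi (t : R) (d : C) : derivative_on_disk phi dphi ->
  (forall u, in_disk u -> cabs (phi u) <= 1) ->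
  angular_derivative phi dphi (expi t) d ->
  forall e, 0 < e -> exists2 r0, r0 < 1 & forall r, r0 < r -> r < 1 ->
    1 - cabs (phi (pol r t)) ^+ 2 <= (cabs d + e) * (1 - r ^+ 2).
Proof.
move=> dF phi1 [a [la [ld a1]]] e e0.
have radial (r : R) : 0 <= r -> r < 1 -> cabs (pol r t - expi t) = 1 - r.
  move=> r0 r1; have -> : pol r t - expi t = (r - 1)%:C%C * expi t.
    by rewrite /pol rmorphB rmorph1; ring.
  by rewrite cabsM cabsR cabs_expi mulr1 ler0_norm; lra.
have e2 : 0 < e / 4 by lra.
have c2 : 1 < 2 :> R by lra.
(* Any aperture above 1 contains the radius, on which the distance to the boundary point is exactly
   1 - r. *)
have [del [del0 hdel]] := ld 2 c2 _ e2.
pose M := cabs d + e / 4.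
have cd := cabs_ge0 d.
(* The last entry ensures 2 M <= (|d| + e)(1 + r). *)
pose r1 := Num.max (Num.max 0 (1 - del)) (1 - e / (4 * (M + e + 1))).
have Me : 0 < 4 * (M + e + 1) by rewrite /M; lra.
exists r1; first by rewrite !gt_max ltr01 !ltrBlDr !ltrDl del0 divr_gt0.
move=> r; rewrite !gt_max => /andP[/andP[r0 rdel] re] rlt1.
have dM (x : R) : r <= x -> x < 1 -> cabs (dphi (pol x t)) <= M.
  move=> rx x1; have x0 : 0 <= x by lra.
  have xD : in_disk (pol x t) by rewrite /in_disk cabs_pol.
  have := hdel _ xD; rewrite radial// cabs_pol// => /(_ ltac:(lra) ltac:(lra)) h.
  have := cabsD d (dphi (pol x t) - d); rewrite addrC subrK.
  by rewrite /M; lra.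
have bound : cabs (a - phi (pol r t)) <= M * (1 - r).
  apply/ler_addgt0Pr => eta eta0.
  have [del2 [del20 hdel2]] := la 2 c2 _ eta0.
  pose s := Num.max ((1 + r) / 2) (1 - del2 / 2).
  have s1 : s < 1 by rewrite gt_max; apply/andP; split; lra.
  have rs : r < s by rewrite lt_max; apply/orP; left; lra.
  have sdel : 1 - s < del2.
    have : 1 - del2 / 2 <= s by rewrite le_max lexx orbT.
    by lra.
  have s0 : 0 <= s by lra.
  have sD : in_disk (pol s t) by rewrite /in_disk cabs_pol.
  have := hdel2 _ sD; rewrite radial// cabs_pol// => /(_ ltac:(lra) sdel) h.
  have := @radial_mvt phi dphi t r s M dF (ltW r0) rs s1.
  have hM (x : R) : r <= x <= s -> cabs (dphi (pol x t)) <= M.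
    by move=> /andP[? ?]; apply: dM; lra.
  move=> /(_ hM) h2.
  have -> : a - phi (pol r t) =
    (phi (pol s t) - phi (pol r t)) - (phi (pol s t) - a) by ring.
  apply: le_trans (cabsBD _ _) _; apply: lerD; last exact: ltW.
  apply: le_trans h2 _; rewrite ler_wpM2l//; first by rewrite /M; lra.
  by lra.
have rD : in_disk (pol r t) by rewrite /in_disk cabs_pol// ltW.
have p1 := phi1 _ rD; have p0 := cabs_ge0 (phi (pol r t)).
have := cabs_sub_ge a (phi (pol r t)); rewrite a1 => h3.
have h4 : 1 - cabs (phi (pol r t)) ^+ 2 <= 2 * (M * (1 - r)) by nra.
apply: le_trans h4 _.
have h5 : 2 * M <= (cabs d + e) * (1 + r).
  have : (1 - r) * (4 * (M + e + 1)) < e.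
    by rewrite -ltr_pdivlMr//; lra.
  by rewrite /M; nra.
have -> : 1 - r ^+ 2 = (1 + r) * (1 - r) by ring.
by rewrite mulrA mulrA ler_wpM2r//; lra.
Qed.

End julia.

(** * Passing to the boundary *)

Section dominated_max.
Context d (T : measurableType d) (R : realType) (mu : {measure set T -> \bar R}).

Lemma integrable_const (E : set T) (k : R) : measurable E -> (mu E < +oo)%E ->
  mu.-integrable E (EFin \o fun=> k).
Proof.
move=> mE muE; apply: measurable_bounded_integrable => //.
by exists `|k|; split; [exact: num_real|move=> M kM x _ /=; exact: ltW].
Qed.

Lemma integrableD_real (E : set T) (f g : T -> R) : measurable E ->
  mu.-integrable E (EFin \o f) -> mu.-integrable E (EFin \o g) ->
  mu.-integrable E (EFin \o (fun t => f t + g t)).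
Proof. by move=> mE fi gi; exact: (integrableD mE fi gi). Qed.

Lemma integrableB_real (E : set T) (f g : T -> R) : measurable E ->
  mu.-integrable E (EFin \o f) -> mu.-integrable E (EFin \o g) ->
  mu.-integrable E (EFin \o (fun t => f t - g t)).
Proof. by move=> mE fi gi; exact: (integrableB mE fi gi). Qed.

(** Only limsup u <= L is known, so u itself may fail to converge. Its maximum with L lies above u,
    converges to L almost everywhere, and is dominated by b + |L|. *)
Lemma cvg_Rintegral_max (E : set T) (u : nat -> T -> R) (L p : T -> R) (b c : R) :
  measurable E -> (mu E < +oo)%E -> (forall n, measurable_fun E (u n)) ->
  (forall n t, E t -> `|u n t| <= b) -> mu.-integrable E (EFin \o L) ->
  measurable_fun E p -> (forall t, E t -> 0 <= p t <= c) ->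
  {ae mu, forall t, E t -> forall e, 0 < e -> \forall n \near \oo, u n t <= L t + e} ->
  mu.-integrable E (EFin \o (fun t => L t * p t)) /\
  (forall n, mu.-integrable E (EFin \o (fun t => Num.max (u n t) (L t) * p t))) /\
  Rintegral mu E (fun t => Num.max (u n t) (L t) * p t) @[n --> \oo] -->
    Rintegral mu E (fun t => L t * p t).
Proof.
move=> mE muE mu_ ub iL mp pc uL.
have mL : measurable_fun E L by apply/measurable_EFinP; case/integrableP : iL.
have mM n : measurable_fun E (fun t => Num.max (u n t) (L t)).
  exact: measurable_maxr.
pose g t := ((b + `|L t|) * c)%:E.
have ig : mu.-integrable E g.
  rewrite (_ : g = fun t => ((c * b)%:E + c%:E * (`|L t|)%:E)%E); last first.
    by apply/funext => t; rewrite /g -EFinM -EFinD; congr EFin; ring.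
  apply: integrableD => //.
    exact: integrable_const.
  by apply: integrableZl => //; exact: integrable_abse iL.
have domE n t : E t -> (`|(Num.max (u n t) (L t) * p t)%:E| <= g t)%E.
  move=> Et; rewrite /g abse_EFin lee_fin normrM; have /andP[p0 p1] := pc t Et.
  rewrite (ger0_norm p0) ler_pM//.
  have := ub n t Et; have := normr_ge0 (L t); have := normr_ge0 (u n t).
  by have [] := leP (u n t) (L t); lra.
have [||||iLp _ cv] := @dominated_convergence _ _ _ mu E mE
  (fun n t => (Num.max (u n t) (L t) * p t)%:E) (fun t => (L t * p t)%:E) g _ _ _ ig.
- by move=> n; apply/measurable_EFinP; exact: measurable_funM.
- by apply/measurable_EFinP; exact: measurable_funM.
- apply: filterS uL => t uLt Et; apply/cvg_EFin; first exact: nearW.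
  apply: (@cvgM _ _ _ _ (fun n => Num.max (u n t) (L t)) (fun=> p t)); last exact: cvg_cst.
  apply/cvgrPdist_le => e e0; apply: filterS (uLt Et _ e0) => n un.
  by rewrite ler_norml; have [?|?] := leP (u n t) (L t); apply/andP; split; lra.
- by apply: aeW => t n; exact: domE.
split => //; split.
  move=> n; apply: le_integrable ig => //.
    by apply/measurable_EFinP; exact: measurable_funM.
  move=> t Et; apply: le_trans (domE n t Et) _; rewrite /g.
  by rewrite abse_EFin lee_fin ler_norm.
have fLp := integrable_fin_num mE iLp.
by apply: fine_cvg; rewrite fineK.
Qed.

End dominated_max.

(** * The logarithm of the de Branges-Rovnyak kernel *)

Section kernel.
Variable R : realType.
Local Notation C := R[i].
Variables (phi dphi : C -> C) (z : C).
Hypothesis dF : derivative_on_disk phi dphi.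
Hypothesis phi1 : forall u, in_disk u -> cabs (phi u) <= 1.
Hypothesis z1 : cabs z < 1.
Hypothesis a1 : cabs (phi z) < 1.

Local Notation a := (phi z).

Lemma derivative_holomorphic : holomorphic_disk phi.
Proof. by move=> w w1; exists (dphi w); exact: dF. Qed.

Let hphi := derivative_holomorphic.

(* [log_kernel r t] is [ln |k_z(r e^(it))|^2] for the de Branges-Rovnyak kernel
   [k_z(w) = (1 - conj(phi z) phi(w)) / (1 - conj(z) w)] *)
Definition log_kernel (r t : R) : R :=
  2 * (ln (cabs (1 - conjc a * phi (pol r t))) - ln (cabs (1 - conjc z * pol r t))).

Let holo_aphi : holomorphic_disk (fun w => conjc a * phi w).
Proof.
move=> w /hphi[d /has_cderivE hd]; eexists; apply/has_cderivE.
exact: kderiv_comp hd (kderivZ_id _ _).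
Qed.

Let holo_zw : holomorphic_disk (fun w : C => conjc z * w).
Proof. by move=> w _; eexists; apply/has_cderivE; exact: kderivZ_id. Qed.

Let aphi_le w : in_disk w -> cabs (conjc a * phi w) <= cabs a.
Proof. by move=> /phi1 h; rewrite cabsM cabsJ ler_piMr ?cabs_ge0. Qed.

Let zw_le w : in_disk w -> cabs (conjc z * w) <= cabs z.
Proof. by move=> h; rewrite cabsM cabsJ ler_piMr ?cabs_ge0// ltW. Qed.

Lemma cont_everywhere (f : R -> R) : (forall a b, cont_on f a b) -> continuous f.
Proof. by move=> cf x; apply: (cf x x); rewrite lexx. Qed.

Let one01 : 0 <= (1 : R) <= 1. Proof. by rewrite ler01 lexx. Qed.

Let cont_ln_a (r b c : R) : 0 <= r < 1 ->
  cont_on (fun t => ln (cabs (1 - conjc a * phi (pol r t)))) b c.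
Proof.
move=> r01; have := @cont_on_ln_1B R _ _ holo_aphi a1 aphi_le 1 r b c one01 r01.
by under eq_fun do rewrite rmorph1 mul1r.
Qed.

Let cont_ln_z (r b c : R) : 0 <= r < 1 ->
  cont_on (fun t => ln (cabs (1 - conjc z * pol r t))) b c.
Proof.
move=> r01; have := @cont_on_ln_1B R _ _ holo_zw z1 zw_le 1 r b c one01 r01.
by under eq_fun do rewrite rmorph1 mul1r.
Qed.

Let cont_log_kernel_on (r b c : R) : 0 <= r < 1 -> cont_on (log_kernel r) b c.
Proof.
move=> r01; apply: cont_onM; first exact: cont_on_cst.
by apply: cont_onB; [exact: cont_ln_a|exact: cont_ln_z].
Qed.

Lemma cont_log_kernel (r : R) : 0 <= r < 1 -> continuous (log_kernel r).
Proof. by move=> r01; apply: cont_everywhere => b c; exact: cont_log_kernel_on. Qed.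

Let den_gt0 (u v : C) : cabs u < 1 -> cabs v <= 1 -> 0 < 1 - cabs u /\
  1 - cabs u <= cabs (1 - conjc u * v) /\ cabs (1 - conjc u * v) <= 2.
Proof.
move=> u1 v1; have uv : cabs (conjc u * v) <= cabs u.
  by rewrite cabsM cabsJ ler_piMr ?cabs_ge0.
have := cabs_sub_ge 1 (conjc u * v); have := cabsBD 1 (conjc u * v).
by rewrite cabs1; split; [|split]; lra.
Qed.

(** Numerator and denominator have modulus at most 2 and at least 1 - |a|, respectively 1 - |z|. The
    bound is independent of [r], as dominated convergence requires. *)
Lemma log_kernel_bound (r t : R) : 0 <= r < 1 -> `|log_kernel r t| <=
  2 * ((`|ln (1 - cabs a)| + ln 2) + (`|ln (1 - cabs z)| + ln 2)).
Proof.
move=> /andP[r0 r1]; have rD : in_disk (pol r t) by rewrite /in_disk cabs_pol.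
have lnB (m x : R) : 0 < m -> m <= x -> x <= 2 -> `|ln x| <= `|ln m| + ln 2.
  move=> m0 mx x2; have x0 : 0 < x by lra.
  have : ln m <= ln x by rewrite ler_ln ?posrE.
  have : ln x <= ln 2 by rewrite ler_ln ?posrE.
  have := ler_norm (ln m); have := ler_norm (- ln m); rewrite normrN => ? ? ? ?.
  have : 0 <= ln 2 :> R by rewrite ln_ge0// ler1n.
  by rewrite ler_norml => ?; apply/andP; split; lra.
have [m0 [m1 m2]] := den_gt0 a1 (phi1 rD).
have [n0 [n1 n2]] := den_gt0 z1 (ltW rD).
rewrite normrM ger0_norm// ler_pM2l//; apply: le_trans (ler_normB _ _) _.
by apply: lerD; exact: lnB.
Qed.

Lemma expR_log_kernel (r t : R) : 0 <= r < 1 -> expR (log_kernel r t) =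
  cabs (1 - conjc a * phi (pol r t)) ^+ 2 / cabs (1 - conjc z * pol r t) ^+ 2.
Proof.
move=> /andP[r0 r1]; have rD : in_disk (pol r t) by rewrite /in_disk cabs_pol.
have [m0 [m1 m2]] := den_gt0 a1 (phi1 rD).
have [n0 [n1 n2]] := den_gt0 z1 (ltW rD).
have A0 : 0 < cabs (1 - conjc a * phi (pol r t)) by exact: lt_le_trans m1.
have B0 : 0 < cabs (1 - conjc z * pol r t) by exact: lt_le_trans n1.
rewrite /log_kernel -ln_div ?posrE// mulr_natl mulr2n expRD.
by rewrite lnK ?posrE ?divr_gt0// -expr2 expr_div_n.
Qed.

(** [poisson_ln_1B] applies to numerator and denominator, with q = |a| and q = |z|. *)
Lemma log_kernel_mean (r : R) : 0 <= r < 1 ->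
  Rintegral (@leb R) (@circ R : set (lebT R))
    (fun t => log_kernel r t * (poisson z t / (2 * pi))) =
  2 * (ln (cabs (1 - conjc a * phi (r%:C%C * z))) -
       ln (cabs (1 - conjc z * (r%:C%C * z)))).
Proof.
move=> r01; have tp : 2 * pi != 0 :> R by rewrite mulf_neq0// gt_eqF// pi_gt0.
have cp b c := @cont_on_poisson R z b c z1.
rewrite Rintegral_circ; last first.
  apply: cont_everywhere => b c; apply: cont_onM; first exact: cont_log_kernel_on.
  by apply: cont_onM; [exact: cp|exact: cont_on_cst].
have := poisson_ln_1B holo_aphi a1 aphi_le r01 z1.
have := poisson_ln_1B holo_zw z1 zw_le r01 z1.
set I2 := sint _ _ _ => P2; set I1 := sint _ _ _ => P1.
rewrite (@eq_sint _ _ (fun t => (2 / (2 * pi)) *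
  (ln (cabs (1 - conjc a * phi (pol r t))) * poisson z t -
   ln (cabs (1 - conjc z * pol r t)) * poisson z t))); last first.
  by move=> t _; rewrite /log_kernel; ring.
have c1 : cont_on (fun t => ln (cabs (1 - conjc a * phi (pol r t))) * poisson z t) 0 (2 * pi).
  by apply: cont_onM; [exact: cont_ln_a|exact: cp].
have c2 : cont_on (fun t => ln (cabs (1 - conjc z * pol r t)) * poisson z t) 0 (2 * pi).
  by apply: cont_onM; [exact: cont_ln_z|exact: cp].
rewrite sintZ; last exact: cont_onB.
rewrite sintB// -/I1 -/I2 P1 P2; move: (2 * pi) tp => b b0.
by field.
Qed.

Lemma cont_expR_log_kernel (r : R) : 0 <= r < 1 -> continuous (fun t => expR (log_kernel r t)).
Proof.
by move=> r01 x; apply: continuous_comp; [exact: cont_log_kernel|exact: continuous_expR].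
Qed.

(** Tends to kz as r tends to 1. The argument is r (r z) because phi is sampled on the circle of
    radius [r] while the Poisson kernel is based at r z. *)
Definition kernel_norm_bound (r : R) : R :=
  (1 + cabs a ^+ 2 - 2 * complex.Re (conjc a * phi (r%:C%C * (r%:C%C * z)))) /
  (1 - (r * cabs z) ^+ 2).

(* the norm of [k_z] in [H^2] does not exceed its norm in the de Branges-Rovnyak
   space: [1 / |1 - conj(z) r e^(it)|^2] is a multiple of the Poisson kernel of [r z] *)
Lemma expR_log_kernel_mean (r : R) : 0 <= r < 1 ->
  Rintegral (@leb R) (@circ R : set (lebT R)) (fun t => expR (log_kernel r t)) <=
  kernel_norm_bound r * (2 * pi).
Proof.
move=> r01; have [r0 r1] := andP r01.
rewrite Rintegral_circ; last exact: cont_expR_log_kernel.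
pose v := r%:C%C * z; have cv : cabs v = r * cabs z.
  by rewrite cabsM cabsR ger0_norm.
have v1 : cabs v < 1 by rewrite cv; have := cabs_ge0 z; have h := z1; nra.
have cp b c := @cont_on_poisson R v b c v1.
have m0 : 0 < 1 - cabs v ^+ 2 by have := cabs_ge0 v; nra.
pose f t := (1 - cabs v ^+ 2)^-1 * ((1 + cabs a ^+ 2) * poisson v t +
  (- 2) * (complex.Re (conjc a * phi (pol r t)) * poisson v t)).
have cR : cont_on (fun t => complex.Re (conjc a * phi (pol r t)) * poisson v t) 0 (2 * pi).
  by apply: cont_onM; [exact: (@cont_on_circle R _ r _ _ holo_aphi r01)|exact: cp].
have cf1 : cont_on (fun t => (1 + cabs a ^+ 2) * poisson v t) 0 (2 * pi).
  by apply: cont_onM; [exact: cont_on_cst|exact: cp].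
have cf2 : cont_on (fun t => (- 2) * (complex.Re (conjc a * phi (pol r t)) * poisson v t)) 0 (2 * pi).
  by apply: cont_onM; [exact: cont_on_cst|exact: cR].
have cf : cont_on f 0 (2 * pi).
  by apply: cont_onM; [exact: cont_on_cst|exact: cont_onD].
apply: (@le_trans _ _ (sint f 0 (2 * pi))).
  apply: le_sint => // [x _|t _]; first exact: cont_expR_log_kernel.
  rewrite expR_log_kernel// /f.
  have rD : in_disk (pol r t) by rewrite /in_disk cabs_pol.
  have -> : conjc z * pol r t = conjc v * expi t.
    by rewrite /v /pol conjM conjc_real; ring.
  rewrite cabs_conjM {1 2}/poisson.
  have e0 : 0 < cabs (expi t - v) ^+ 2.
    by rewrite exprn_gt0// cabs_gt0 expi_sub_neq0.
  have -> : (1 - cabs v ^+ 2)^-1 * ((1 + cabs a ^+ 2) *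
      ((1 - cabs v ^+ 2) / cabs (expi t - v) ^+ 2) + - 2 *
      (complex.Re (conjc a * phi (pol r t)) *
        ((1 - cabs v ^+ 2) / cabs (expi t - v) ^+ 2))) =
      (1 + cabs a ^+ 2 - 2 * complex.Re (conjc a * phi (pol r t))) /
      cabs (expi t - v) ^+ 2.
    move: (cabs (expi t - v) ^+ 2) e0 (1 - cabs v ^+ 2) m0 => D D0 m m0'.
    by field; rewrite (gt_eqF D0) (gt_eqF m0').
  rewrite ler_pM2r ?invr_gt0//.
  have : cabs (1 - conjc a * phi (pol r t)) ^+ 2 =
      1 - 2 * complex.Re (conjc a * phi (pol r t)) + cabs (conjc a * phi (pol r t)) ^+ 2.
    by rewrite !sqr_cabs; case: (conjc a * phi (pol r t)) => x y /=; ring.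
  (* Here |phi| <= 1 replaces |conj(a) phi|^2 by the constant |a|^2; the rest is the real part of a
     holomorphic function. *)
  move=> ->; have := aphi_le rD; have := cabs_ge0 (conjc a * phi (pol r t)).
  by have := cabs_ge0 a; nra.
rewrite sintZ; last exact: cont_onD.
rewrite sintD// sintZ; last exact: cp.
rewrite poisson_mass// sintZ// (poisson_formula holo_aphi r01 v1).
by rewrite /kernel_norm_bound -cv -/v le_eqVlt; apply/orP; left; apply/eqP; ring.
Qed.

Local Notation kz := ((1 - cabs (phi z) ^+ 2) / (1 - cabs z ^+ 2)).

Lemma kz_gt0 : 0 < kz.
Proof.
have h := a1; have h' := z1; have := cabs_ge0 a; have := cabs_ge0 z => ? ?.
by rewrite divr_gt0//; nra.
Qed.

(** Schwarz-Pick followed by [julia] with error |d| e, so that the logarithm exceeds its target by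
    at most ln (1 + e) <= e. The condition [d != 0] makes [ln (cabs d)] a genuine logarithm, as
    [ln 0 = 0] by convention. *)
Lemma log_kernel_julia (t : R) (d : C) :
  angular_derivative phi dphi (expi t) d -> d != 0 ->
  forall e, 0 < e -> exists2 r0, r0 < 1 & forall r, 0 <= r -> r0 < r -> r < 1 ->
    log_kernel r t <= ln (cabs d) + ln kz + e.
Proof.
move=> ad d0 e e0; have cd : 0 < cabs d by rewrite cabs_gt0.
have cde : 0 < cabs d * e by rewrite mulr_gt0.
have [r0 r01 hr0] := julia dF phi1 ad cde.
exists r0 => // r r_ge0 r0r r1; have rD : in_disk (pol r t) by rewrite /in_disk cabs_pol.
have r2 : 0 < 1 - r ^+ 2 by nra.
have K : expR (log_kernel r t) <= kz * (cabs d * (1 + e)).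
  rewrite expR_log_kernel ?r_ge0//.
  have [n0 [n1 n2]] := den_gt0 z1 (ltW rD).
  have B0 : 0 < cabs (1 - conjc z * pol r t) by exact: lt_le_trans n1.
  rewrite ler_pdivrMr ?exprn_gt0//.
  have := schwarz_pick hphi phi1 a1 z1 rD; rewrite cabs_pol// .
  have := hr0 _ r0r r1.
  have z2 : 0 < 1 - cabs z ^+ 2 by have h := z1; have := cabs_ge0 z; nra.
  have a2 : 0 < 1 - cabs a ^+ 2 by have h := a1; have := cabs_ge0 a; nra.
  move=> h1 h2; set Y := cabs (1 - conjc z * pol r t) ^+ 2.
  have -> : kz * (cabs d * (1 + e)) * Y =
    (1 - cabs a ^+ 2) * (cabs d * (1 + e)) * Y / (1 - cabs z ^+ 2).
    by ring.
  rewrite ler_pdivlMr// /Y.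
  rewrite -(ler_pM2r r2); apply: le_trans (_ : _ <= (1 - cabs a ^+ 2) *
    (1 - cabs (phi (pol r t)) ^+ 2) * cabs (1 - conjc z * pol r t) ^+ 2) _.
    by apply: le_trans h2; rewrite le_eqVlt; apply/orP; left; apply/eqP; ring.
  have -> : (1 - cabs a ^+ 2) * (cabs d * (1 + e)) * cabs (1 - conjc z * pol r t) ^+ 2 *
    (1 - r ^+ 2) = (1 - cabs a ^+ 2) * ((cabs d + cabs d * e) * (1 - r ^+ 2)) *
    cabs (1 - conjc z * pol r t) ^+ 2 by ring.
  by rewrite ler_pM2r ?exprn_gt0// ler_pM2l.
have k0 := kz_gt0; have e1 : 0 < 1 + e by lra.
have : log_kernel r t <= ln (kz * (cabs d * (1 + e))).
  have p0 : 0 < kz * (cabs d * (1 + e)) by rewrite mulr_gt0// mulr_gt0.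
  by rewrite -[leLHS]expRK ler_ln ?posrE ?expR_gt0.
have cde1 : 0 < cabs d * (1 + e) by rewrite mulr_gt0.
rewrite lnM ?posrE// lnM ?posrE//.
have : ln (1 + e) <= e by apply: le_ln1Dx; lra.
lra.
Qed.

End kernel.

(** * Limits as the radius tends to 1 *)

Section radial_limits.
Variable R : realType.
Local Notation C := R[i].

Definition rad_seq (n : nat) : R := 1 - n.+2%:R^-1.

Lemma rad_seq_itv n : 0 <= rad_seq n < 1.
Proof.
have n0 : 0 < n.+2%:R^-1 :> R by rewrite invr_gt0.
have n1 : n.+2%:R^-1 <= 1 :> R by rewrite invf_le1// ler1n.
by rewrite /rad_seq subr_ge0 n1 ltrBlDr ltrDl n0.
Qed.

Lemma cvg_rad_seq : rad_seq n @[n --> \oo] --> (1 : R).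
Proof.
rewrite -[X in _ --> X]subr0; apply: cvgB; first exact: cvg_cst.
by have := @cvg_harmonic R; rewrite -cvg_shiftS.
Qed.

(** Serves both for real parts and for moduli, which are 1-Lipschitz. *)
Lemma cvg_radial (F : C -> R) (h : C -> C) (z : C) (s : nat -> R) :
  (forall u v, `|F u - F v| <= cabs (u - v)) -> ccont h z ->
  s n @[n --> \oo] --> (1 : R) ->
  F (h ((s n)%:C%C * z)) @[n --> \oo] --> F (h z).
Proof.
move=> lipF ch s1; apply/cvgrPdist_lt => e /ch[d d0 hd].
have z0 : 0 < cabs z + 1 by have := cabs_ge0 z; lra.
have dz : 0 < d / (cabs z + 1) by rewrite divr_gt0.
have /cvgrPdist_lt/(_ _ dz) := s1; apply: filterS => n.
rewrite distrC ltr_pdivlMr// => sn; rewrite distrC.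
apply: le_lt_trans (lipF _ _) _; apply: hd.
have -> : (s n)%:C%C * z - z = (s n - 1)%:C%C * z by rewrite rmorphB rmorph1; ring.
by rewrite cabsM cabsR; have := cabs_ge0 z; have := normr_ge0 (s n - 1); nra.
Qed.

Lemma Re_lip (u v : C) : `|complex.Re u - complex.Re v| <= cabs (u - v).
Proof. by rewrite -ReB; exact: Re_le_cabs. Qed.

Lemma cabs_lip (u v : C) : `|cabs u - cabs v| <= cabs (u - v).
Proof.
rewrite ler_norml; have := cabs_sub_ge u v; have := cabs_sub_ge v u.
by rewrite (cabsB v u) => ? ?; apply/andP; split; lra.
Qed.

Variables (phi : C -> C) (z : C).
Hypotheses (hphi : holomorphic_disk phi) (z1 : cabs z < 1) (a1 : cabs (phi z) < 1).
Local Notation a := (phi z).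
Local Notation kz := ((1 - cabs a ^+ 2) / (1 - cabs z ^+ 2)).

Let kcont_aphi : kcont (fun w : C => conjc a * phi w) z.
Proof.
apply: kcontM; first exact: kcont_cst.
by apply/ccontE; exact: holo_ccont.
Qed.

Let cabs_1Bsqr (u : C) : cabs u < 1 -> cabs (1 - conjc u * u) = 1 - cabs u ^+ 2.
Proof.
move=> u1; rewrite mulrC mulJc.
have -> : 1 - (cabs u ^+ 2)%:C%C = (1 - cabs u ^+ 2)%:C%C :> C.
  by rewrite rmorphB rmorph1.
rewrite cabsR ger0_norm//.
by rewrite subr_ge0 exprn_ile1// ?cabs_ge0// ltW.
Qed.

Lemma cvg_kernel_norm_bound :
  kernel_norm_bound phi z (rad_seq n) @[n --> \oo] --> kz.
Proof.
have z2 : 1 - cabs z ^+ 2 != 0.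
  by rewrite gt_eqF// subr_gt0 exprn_ilt1// ?cabs_ge0.
have cr2 : rad_seq n * rad_seq n @[n --> \oo] --> (1 : R).
  by rewrite -[X in _ --> X]mulr1; apply: cvgM; exact: cvg_rad_seq.
have -> : kz = (1 + cabs a ^+ 2 - 2 * complex.Re (conjc a * phi z)) /
    (1 - (1 * cabs z) ^+ 2).
  by rewrite mul1r [conjc _ * _]mulrC mulJc /=; congr (_ / _); ring.
rewrite /kernel_norm_bound; apply: cvgM; last first.
  apply: cvgV; first by rewrite mul1r.
  apply: cvgB; first exact: cvg_cst.
  rewrite expr2; under eq_fun do rewrite expr2.
  by apply: cvgM; (apply: cvgM; [exact: cvg_rad_seq|exact: cvg_cst]).
apply: cvgB; first exact: cvg_cst.
apply: cvgM; first exact: cvg_cst.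
under eq_fun do rewrite mulrA -rmorphM.
exact: (cvg_radial (h := fun w => conjc a * phi w) Re_lip (iffRL (ccontE _ _) kcont_aphi) cr2).
Qed.

Lemma cvg_log_kernel_mean :
  2 * (ln (cabs (1 - conjc a * phi ((rad_seq n)%:C%C * z))) -
       ln (cabs (1 - conjc z * ((rad_seq n)%:C%C * z)))) @[n --> \oo] --> 2 * ln kz.
Proof.
have a0 : 0 < 1 - cabs a ^+ 2 by rewrite subr_gt0 exprn_ilt1// ?cabs_ge0.
have z0 : 0 < 1 - cabs z ^+ 2 by rewrite subr_gt0 exprn_ilt1// ?cabs_ge0.
rewrite ln_div ?posrE//; apply: cvgM; first exact: cvg_cst.
apply: cvgB.
  apply: continuous_cvg; first exact: continuous_ln.
  rewrite -cabs_1Bsqr//.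
  apply: (cvg_radial (h := fun w => 1 - conjc a * phi w) cabs_lip _ cvg_rad_seq).
  apply/ccontE; apply: kcontD; first exact: kcont_cst.
  exact: kcontN.
apply: continuous_cvg; first exact: continuous_ln.
rewrite -cabs_1Bsqr//.
apply: (cvg_radial (h := fun w => 1 - conjc z * w) cabs_lip _ cvg_rad_seq).
by apply/ccontE; exact: kcont_poisson_den.
Qed.

End radial_limits.

(** * The inequality with the free parameter [lam] *)

Section main_inequality.
Variable R : realType.
Local Notation C := R[i].
Variables (phi dphi : C -> C) (z : C) (E : set R) (dphiT : R -> C).
Hypothesis dF : derivative_on_disk phi dphi.
Hypothesis phi1 : forall u, in_disk u -> cabs (phi u) <= 1.
Hypothesis z1 : cabs z < 1.
Hypothesis a1 : cabs (phi z) < 1.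
Hypothesis mE : lmeasurable E.
Hypothesis EX : E `<=` @circ R.
Hypothesis adE : {ae (@leb R), forall t : lebT R, E t ->
  angular_derivative phi dphi (expi t) (dphiT t)}.
Hypothesis d0E : {ae (@leb R), forall t : lebT R, E t -> dphiT t != 0}.
Hypothesis iL : (@leb R).-integrable (E : set (lebT R))
  (fun t => (ln (cabs (dphiT t)))%:E).

Local Notation X := (@circ R : set (lebT R)).
Local Notation kz := ((1 - cabs (phi z) ^+ 2) / (1 - cabs z ^+ 2)).
Local Notation c := ((1 + cabs z) / (1 - cabs z)).
Local Notation w := (harm_meas z E).
Local Notation p := (fun t : R => poisson z t / (2 * pi)).

Lemma harm_density_cont : continuous p.
Proof.
apply: cont_everywhere => x y; apply: cont_onM; last exact: cont_on_cst.
exact: cont_on_poisson.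
Qed.

(** From |e^(it) - z| >= 1 - |z|; this is the source of the factor (1 + |z|) / (1 - |z|) in the
    theorem. *)
Lemma harm_density_bounds (t : R) : 0 <= p t <= c / (2 * pi).
Proof.
have tp : 0 < 2 * pi :> R by rewrite mulr_gt0// pi_gt0.
apply/andP; split; first by rewrite divr_ge0 ?poisson_ge0// ltW.
rewrite ler_pM2r ?invr_gt0// /poisson.
have cz := cabs_ge0 z; have h1 := z1.
have e1 : 1 - cabs z <= cabs (expi t - z).
  by have := cabs_sub_ge (expi t) z; rewrite cabs_expi.
have e0 : 0 < cabs (expi t - z) by lra.
rewrite ler_pdivrMr ?exprn_gt0// mulrAC ler_pdivlMr; last lra.
have : (1 - cabs z) ^+ 2 <= cabs (expi t - z) ^+ 2.
  by rewrite ler_pXn2r// nnegrE; lra.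
by nra.
Qed.

Lemma measurable_X : measurable X.
Proof. by apply: lmeasurable_borel; exact: measurable_circ. Qed.

Let F : set (lebT R) := X `\` E.

Let mF : measurable F.
Proof. by apply: measurableD => //; exact: measurable_X. Qed.

Let FX : F `<=` X. Proof. exact: subDsetl. Qed.

Let XEF : X = E `|` F. Proof. by rewrite /F setDUK. Qed.

Let dEF : [disjoint (E : set (lebT R)) & F].
Proof. by apply/disj_setPS => t [Et [_]]. Qed.

Let integrable_sub (f : R -> R) (D : set (lebT R)) : measurable D -> D `<=` X ->
  continuous f -> (@leb R).-integrable D (EFin \o f).
Proof.
move=> mD DX cf; apply: (integrableS measurable_X mD DX).
exact: circ_integrable.
Qed.

Let split_integral (f : R -> R) : continuous f ->
  Rintegral (@leb R) X f = Rintegral (@leb R) E f + Rintegral (@leb R) F f.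
Proof.
by move=> cf; rewrite XEF Rintegral_setU// -XEF; exact: circ_integrable.
Qed.

Lemma harm_density_mass : Rintegral (@leb R) X p = 1.
Proof.
have tp : 2 * pi != 0 :> R by rewrite mulf_neq0// gt_eqF// pi_gt0.
rewrite Rintegral_circ; last exact: harm_density_cont.
rewrite (@eq_sint _ _ (fun t => (2 * pi)^-1 * poisson z t)); last first.
  by move=> t _; rewrite mulrC.
rewrite sintZ; last exact: cont_on_poisson.
by rewrite poisson_mass// mulVf.
Qed.

Let massF : Rintegral (@leb R) F p = 1 - w.
Proof.
have := split_integral harm_density_cont; rewrite harm_density_mass => h.
by apply: (addrI w); rewrite [RHS]addrC subrK; exact: esym h.
Qed.

Lemma harm_meas_le1 : 0 <= w <= 1.
Proof.
have pos D : 0 <= Rintegral (@leb R) D p.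
  by apply: Rintegral_ge0 => t _; case/andP: (harm_density_bounds t).
by rewrite /harm_meas pos/= -subr_ge0 -massF pos.
Qed.

Let leb_fin : (@leb R E < +oo)%E.
Proof.
have iX := circ_integrable (@cst_continuous R R 1).
have := integrable_lty measurable_X iX.
rewrite [X in (X < _)%E -> _](_ : _ = (@leb R X)); last first.
  by under eq_integral do rewrite /=; rewrite integral_cst ?mul1e//; exact: measurable_X.
apply: le_lt_trans; apply: le_measure => //; rewrite inE//.
exact: measurable_X.
Qed.

(** The tangent to the logarithm at [lam], in place of Jensen's inequality: no normalization by the
    harmonic measure of the complement, possibly zero, is required. *)
Let tangent (x lam : R) : 0 < lam -> x <= ln lam - 1 + expR x / lam.
Proof.
move=> l0; have := @expR_ge1Dx R (x - ln lam).
by rewrite expRB lnK ?posrE//; lra.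
Qed.

Local Notation logU n := (log_kernel phi z (@rad_seq R n)).

Let hphi := derivative_holomorphic dF.

Let contU n : continuous (logU n).
Proof. exact: (cont_log_kernel dF phi1 z1 a1 (@rad_seq_itv R n)). Qed.

Let contUp n : continuous (fun t => logU n t * p t).
Proof. by move=> t; apply: cvgM; [exact: contU|exact: harm_density_cont]. Qed.

(** After [tangent], the harmonic density is bounded by its maximum and the integral of |k|^2 is
    enlarged from F to the whole circle, where [expR_log_kernel_mean] controls it. *)
Let integral_F n (lam : R) : 0 < lam ->
  Rintegral (@leb R) F (fun t => logU n t * p t) <=
  (ln lam - 1) * (1 - w) + c / lam * kernel_norm_bound phi z (@rad_seq R n).
Proof.
move=> l0; have rn := @rad_seq_itv R n.
have tp : 0 < 2 * pi :> R by rewrite mulr_gt0// pi_gt0.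
have cz := cabs_ge0 z; have h1 := z1.
have c0 : 0 <= c by rewrite divr_ge0//; lra.
have cexp := cont_expR_log_kernel dF phi1 z1 a1 rn.
have cp := harm_density_cont.
have i1 : (@leb R).-integrable F (EFin \o (fun t => (ln lam - 1) * p t)).
  by apply: integrable_sub => // t; apply: cvgM; [exact: cvg_cst|exact: cp].
pose K := c / (2 * pi) / lam.
have K0 : 0 <= K by rewrite /K divr_ge0 ?(ltW l0)// divr_ge0 ?(ltW tp).
have i2 : (@leb R).-integrable F (EFin \o (fun t => K * expR (logU n t))).
  by apply: integrable_sub => // t; apply: cvgM; [exact: cvg_cst|exact: cexp].
apply: (@le_trans _ _ (Rintegral (@leb R) F
  (fun t => (ln lam - 1) * p t + K * expR (logU n t)))).
  apply: le_Rintegral => // [||t _].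
  - exact: integrable_sub.
  - exact: integrableD_real.
  - have /andP[p0 p1] := harm_density_bounds t.
    have := tangent (logU n t) l0; set U := logU n t => hU.
    have : U * p t <= (ln lam - 1 + expR U / lam) * p t by rewrite ler_wpM2r.
    have : expR U / lam * p t <= expR U / lam * (c / (2 * pi)).
      by rewrite ler_wpM2l// divr_ge0 ?expR_ge0// ltW.
    have -> : K * expR U = expR U / lam * (c / (2 * pi)) by rewrite /K; ring.
    by lra.
rewrite RintegralD// RintegralZl ?massF//; last exact: integrable_sub.
rewrite lerD2l RintegralZl//; last exact: integrable_sub.
have : Rintegral (@leb R) F (fun t => expR (logU n t)) <=
    kernel_norm_bound phi z (@rad_seq R n) * (2 * pi).
  apply: le_trans (expR_log_kernel_mean dF phi1 z1 a1 rn).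
  rewrite split_integral// lerDr; apply: Rintegral_ge0 => t _.
  exact: expR_ge0.
move=> /(ler_wpM2l K0) /le_trans; apply.
rewrite le_eqVlt; apply/orP; left; apply/eqP; rewrite /K.
by move: (2 * pi) tp => b b0; field; rewrite !gt_eqF//; lra.
Qed.

(** The mean of log |k|^2 is split over E and F on the circles of radius [rad_seq n]. On E the
    integrand is raised to its maximum with L = ln |phi'| + ln kz, so that all terms of the bound
    converge as n grows. *)
Lemma kernel_inequality (lam : R) : 0 < lam ->
  2 * ln kz <=
  Rintegral (@leb R) E (fun t => ln (cabs (dphiT t)) * p t) + w * ln kz +
  ((ln lam - 1) * (1 - w) + c / lam * kz).
Proof.
move=> l0; have cp := harm_density_cont.
pose L (t : lebT R) := ln (cabs (dphiT t)) + ln kz.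
have iK : (@leb R).-integrable E (EFin \o (fun=> ln kz)) by exact: integrable_const.
have iL' : (@leb R).-integrable E (EFin \o L).
  exact: integrableD_real.
have mcont (f : R -> R) : continuous f -> measurable_fun (E : set (lebT R)) f.
  move=> cf; have := integrable_sub mE EX cf => /integrableP[/measurable_EFinP].
  by [].
have uL : {ae (@leb R), forall t : lebT R, E t -> forall e, 0 < e ->
    \forall n \near \oo, logU n t <= L t + e}.
  apply: filterS2 adE d0E => t ad d0 Et e e0.
  have [r0 r01 hr] := log_kernel_julia dF phi1 z1 a1 (ad Et) (d0 Et) e0.
  have /cvgrPdist_lt/(_ (1 - r0)) := @cvg_rad_seq R.
  rewrite subr_gt0 => /(_ r01); apply: filterS => n.
  have /andP[rn0 rn1] := @rad_seq_itv R n.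
  rewrite ltr_norml => /andP[_ rn]; apply: hr => //.
  by move: rn; rewrite ltrD2l ltrN2.
have [iLp [iM cM]] := @cvg_Rintegral_max _ (lebT R) R (@leb R) E
  (fun n => logU n) L p _ _ mE leb_fin (fun n => mcont _ (contU (n := n)))
  (fun n t _ => log_kernel_bound phi1 z1 a1 t (@rad_seq_itv R n)) iL' (mcont _ cp)
  (fun t _ => harm_density_bounds t) uL.
have bound n : 2 * (ln (cabs (1 - conjc (phi z) * phi ((@rad_seq R n)%:C%C * z))) -
    ln (cabs (1 - conjc z * ((@rad_seq R n)%:C%C * z)))) <=
    Rintegral (@leb R) E (fun t => Num.max (logU n t) (L t) * p t) +
    ((ln lam - 1) * (1 - w) + c / lam * kernel_norm_bound phi z (@rad_seq R n)).
  rewrite -(log_kernel_mean dF phi1 z1 a1 (@rad_seq_itv R n)).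
  rewrite split_integral; last exact: contUp.
  apply: lerD; last exact: integral_F.
  apply: le_Rintegral => // [|t _]; first exact: (integrable_sub mE EX (contUp (n := n))).
  have /andP[p0 _] := harm_density_bounds t.
  by rewrite ler_wpM2r// le_max lexx.
have H : 2 * ln kz <= Rintegral (@leb R) E (fun t => L t * p t) +
    ((ln lam - 1) * (1 - w) + c / lam * kz).
  apply: (ler_cvg_to (cvg_log_kernel_mean hphi z1 a1) _ (nearW _ bound)).
  apply: cvgD => //; apply: cvgD; first exact: cvg_cst.
  apply: cvgM; first exact: cvg_cst.
  exact: cvg_kernel_norm_bound.
apply: le_trans H _; rewrite lerD2r.
have iKp : (@leb R).-integrable E (EFin \o (fun t => ln kz * p t)).
  by apply: integrable_sub => // t; apply: cvgM; [exact: cvg_cst|exact: cp].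
have iLp' : (@leb R).-integrable E (EFin \o (fun t => ln (cabs (dphiT t)) * p t)).
  rewrite (_ : (fun t => _) = fun t => L t * p t - ln kz * p t).
    exact: integrableB_real.
  by apply/funext => t; rewrite /L; ring.
rewrite (_ : Rintegral _ _ (fun t => L t * p t) =
  Rintegral (@leb R) E (fun t => ln (cabs (dphiT t)) * p t + ln kz * p t)); last first.
  by apply: eq_Rintegral => t _; rewrite /L mulrDl.
rewrite RintegralD// lerD2l RintegralZl//; last exact: integrable_sub.
by rewrite mulrC.
Qed.

End main_inequality.

(** * The outer function, the choice of [lam] and the conclusion *)

Lemma sup_norm_ge (R : realType) (phi : R[i] -> R[i]) (u : R[i]) : Hinf phi ->
  in_disk u -> cabs (phi u) <= sup_norm_disk phi.
Proof.
move=> [_ [M phiM]] u1; apply: ub_le_sup; last by exists u.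
by exists M => _ [v v1 <-]; exact: phiM.
Qed.

(** Off E the modulus is 1, with logarithm 0, and the real part of the Herglotz kernel is the
    Poisson kernel. *)
Lemma outer_absE (R : realType) (E : set R) (d : R -> R[i]) (z : R[i]) :
  E `<=` @circ R -> cabs z < 1 ->
  outer_abs (fun t => if `[< E t >] then cabs (d t) else 1) z =
  expR (Rintegral (@leb R) (E : set (lebT R))
    (fun t => ln (cabs (d t)) * (poisson z t / (2 * pi)))).
Proof.
move=> EX z1; rewrite /outer_abs; congr expR.
rewrite -{2}(setIidr EX) Rintegral_mkcondr.
apply: eq_Rintegral => t _; rewrite outer_kernelE// /patch.
have [Et|Et] := asboolP (E t).
  by rewrite mem_set//; ring.
by rewrite memNset// ln1 mulr0 mul0r.
Qed.

(* The choice of [lam] optimizes the bound; for [w = 1] one lets [lam] tend to infinity. *)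
Lemma optimize_tangent (R : realType) (k c w S : R) : 0 < k -> 0 < c ->
  0 <= w <= 1 ->
  (forall lam, 0 < lam ->
    2 * ln k <= S + w * ln k + ((ln lam - 1) * (1 - w) + c / lam * k)) ->
  k <= expR S * (if w == 1 then 1 else ((1 - w)^-1 * c) `^ (1 - w)).
Proof.
move=> k0 c0 /andP[w0 w1] H; rewrite -{1}(lnK k0).
have [wE|wn1] := eqVneq w 1.
  rewrite mulr1 ler_expR; apply/ler_addgt0Pr => e e0.
  have := H (c * k / e); rewrite wE subrr mulr0 add0r mul1r.
  rewrite divr_gt0 ?mulr_gt0// => /(_ isT).
  have -> : c / (c * k / e) * k = e by field; rewrite !gt_eqF.
  by lra.
have w10 : 0 < 1 - w by rewrite subr_gt0 lt_neqAle wn1.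
have cw : 0 < (1 - w)^-1 * c by rewrite mulr_gt0// invr_gt0.
rewrite /powR (gt_eqF cw) -expRD ler_expR.
have := H ((1 - w)^-1 * c * k); rewrite mulr_gt0// => /(_ isT).
rewrite lnM ?posrE//.
have -> : c / ((1 - w)^-1 * c * k) * k = 1 - w.
  by field; rewrite !gt_eqF.
by lra.
Qed.

(** Since [ln 0 = 0] by convention, integrability of [ln (cabs (dphiT t))] would not exclude zeros
    of phi'; the integrability of log |phi'| over E is therefore expressed together with
    nonvanishing almost everywhere. *)
Theorem theorem1 (R : realType) (phi dphi : R[i] -> R[i]) (E : set R)
  (dphiT : R -> R[i]) :
  Hinf phi -> derivative_on_disk phi dphi ->
  nonconstant_disk phi -> sup_norm_disk phi = 1 ->
  lmeasurable E -> E `<=` `[0, 2 * pi[ ->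
  {ae (@leb R), forall t : lebT R, E t ->
     angular_derivative phi dphi (expi t) (dphiT t)} ->
  {ae (@leb R), forall t : lebT R, E t -> dphiT t != 0} ->
  (@leb R).-integrable (E : set (lebT R)) (fun t => (ln (cabs (dphiT t)))%:E) ->
  forall z : R[i], in_disk z ->
    let w := harm_meas z E in
    (1 - cabs (phi z) ^+ 2) / (1 - cabs z ^+ 2) <=
    outer_abs (fun t => if `[< E t >] then cabs (dphiT t) else 1) z *
    (if w == 1 then 1
     else ((1 - w)^-1 * ((1 + cabs z) / (1 - cabs z))) `^ (1 - w)).

Proof.
move=> hH dF _ sup1 mE EX adE d0E iL z z1; cbv zeta.
have phi1 u : in_disk u -> cabs (phi u) <= 1.
  by move=> u1; rewrite -sup1; exact: sup_norm_ge.
(* If |phi(z)| = 1 the left-hand side is 0; otherwise |phi(z)| < 1, as the logarithm of the kernel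
   requires. *)
have [a1|a1] := eqVneq (cabs (phi z)) 1.
  rewrite a1 expr1n subrr mul0r mulr_ge0 ?expR_ge0//.
  by case: ifP => _; rewrite ?powR_ge0.
have {}a1 : cabs (phi z) < 1 by rewrite lt_neqAle a1 phi1.
have cz := cabs_ge0 z; have z1' : cabs z < 1 by [].
rewrite outer_absE//; apply: optimize_tangent.
- exact: kz_gt0.
- by rewrite divr_gt0//; lra.
- exact: harm_meas_le1.
- by move=> lam; exact: (kernel_inequality dF).
Qed.
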